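(* Let $\vec{\mathcal H}$ be a finite sequence of conjugacy classes of finitely generated subgroups of $F(\mathcal B)$, and suppose $\mathrm{minlex}(\vec{\mathcal H}')>1$ for some (equivalently any) Gersten representative $\vec{\mathcal H}'$ of $\vec{\mathcal H}$. Then the following are equivalent: (1) there is $\alpha\in\mathrm{Aut}(F(\mathcal B))$ such that $\Sigma(\alpha\vec{\mathcal H})$ can be visibly cleaved; (2) for some Gersten representative $\vec{\mathcal H}'$ of $\vec{\mathcal H}$, $\Sigma(\vec{\mathcal H}')$ can be visibly cleaved; (3) for every Gersten representative $\vec{\mathcal H}'$ of $\vec{\mathcal H}$, $\Sigma(\vec{\mathcal H}')$ can be visibly cleaved.
   Context: $F(\mathcal B)$ is the free group on a finite set $\mathcal B$, identified with $\pi_1$ of the rose $R_{\mathcal B}$. For a conjugacy class $[[H]]$ of a finitely generated subgroup, $\Sigma([[H]])$ is the core of the covering graph of $R_{\mathcal B}$ corresponding to $H$, a finite graph with oriented edges labeled in $\mathcal B^{\pm1}$ (empty if $H=1$); for sequences, componentwise, and automorphisms act componentwise. For $b\in\mathcal B$, $n(b,\vec{\mathcal H})$ is the number of edges of $\Sigma(\vec{\mathcal H})$ labeled $b^{\pm1}$ and $\mathrm{minlex}=\min_b n(b,\cdot)$. The complexity is the total number of edges of $\Sigma(\vec{\mathcal H})$; $\vec{\mathcal H}'$ is a Gersten representative of $\vec{\mathcal H}$ if $\vec{\mathcal H}'=\beta\vec{\mathcal H}$ for some automorphism $\beta$ and has minimal complexity in the orbit $\mathrm{Aut}(F(\mathcal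 B))\vec{\mathcal H}$. A sequence $(\Sigma_i)_{i\in I}$ of labeled graphs can be visibly cleaved if there is a partition $\mathcal B=\mathcal B'\sqcup\mathcal B''$ into two nonempty sets and an index $i_0\in I$ such that $\Sigma_{i_0}$ is the wedge (union along a single common vertex) of a connected graph all of whose labels lie in $\mathcal B'^{\pm1}$ and a connected graph all of whose labels lie in $\mathcal B''^{\pm1}$, and for each $i\neq i_0$ the labels of $\Sigma_i$ all lie in $\mathcal B'^{\pm1}$ or all lie in $\mathcal B''^{\pm1}$. *)

(* Defs.v *)
From mathcomp Require Import all_boot.
Set Implicit Arguments. Unset Strict Implicit. Unset Printing Implicit Defensive.

Section FreeGroup.
Variable B : finType.

(* a letter (b, false) is b, (b, true) is b^-1 *)
Definition letter := (B * bool)%type.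
Definition word := seq letter.

Definition linv (l : letter) : letter := (l.1, ~~ l.2).
Definition winv (w : word) : word := rev (map linv w).

Definition rstep (l : letter) (acc : word) : word :=
  match acc with
  | y :: acc' => if y == linv l then acc' else l :: acc
  | [::] => [:: l]
  end.
Definition reduce (w : word) : word := foldr rstep [::] w.
Definition reduced (w : word) : bool := reduce w == w.

Definition in_sub (gens : seq word) (w : word) : Prop :=
  exists s : seq (nat * bool),
    all (fun x => x.1 < size gens) s /\
    reduce (flatten [seq if x.2 then winv (nth [::] gens x.1) else nth [::] gens x.1
                    | x <- s]) = reduce w.

Definition ext (a : B -> word) (w : word) : word :=
  reduce (flatten [seq if l.2 then winv (a l.1) else a l.1 | l <- w]).

Definition is_aut (a : B -> word) : Prop :=
  exists a' : B -> word, forall w, reduced w ->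
    ext a' (ext a w) = w /\ ext a (ext a' w) = w.

(* action of an automorphism on a sequence of f.g. subgroups (given by generators) *)
Definition aut_act (a : B -> word) (Hs : seq (seq word)) : seq (seq word) :=
  map (map (ext a)) Hs.

(* finite graphs with oriented edges (src, label, tgt), labels in B;
   vertices are 0 .. nv-1 *)
Record lgraph := LGraph { nv : nat; edges : seq (nat * B * nat) }.
Definition G0 : lgraph := LGraph 0 [::].

Definition esrc (e : nat * B * nat) := e.1.1.
Definition elab (e : nat * B * nat) := e.1.2.
Definition etgt (e : nat * B * nat) := e.2.

Definition wf_graph (G : lgraph) : bool :=
  all (fun e => (esrc e < nv G) && (etgt e < nv G)) (edges G).

Definition folded (G : lgraph) : Prop :=
  uniq (edges G) /\
  forall e1 e2, e1 \in edges G -> e2 \in edges G -> e1 != e2 ->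
    elab e1 != elab e2 \/ (esrc e1 != esrc e2 /\ etgt e1 != etgt e2).

Definition degree (G : lgraph) (x : nat) : nat :=
  count (fun e => esrc e == x) (edges G) + count (fun e => etgt e == x) (edges G).

(* walks: sequences of (edge, traversed backwards?) *)
Definition wstep (G : lgraph) (o : option nat) (s : (nat * B * nat) * bool) :=
  match o with
  | None => None
  | Some c =>
      if s.1 \in edges G then
        if ~~ s.2 then (if esrc s.1 == c then Some (etgt s.1) else None)
        else (if etgt s.1 == c then Some (esrc s.1) else None)
      else None
  end.
Definition walk_end (G : lgraph) (x : nat) (p : seq ((nat * B * nat) * bool)) :=
  foldl (wstep G) (Some x) p.
Definition walk_label (p : seq ((nat * B * nat) * bool)) : word :=
  [seq (elab s.1, s.2) | s <- p].

Definition conn_by (G : lgraph) (E : pred (nat * B * nat)) (x y : nat) : Prop :=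
  exists p, all (fun s => E s.1) p /\ walk_end G x p = Some y.

Definition connected (G : lgraph) : Prop :=
  forall x y, x < nv G -> y < nv G -> conn_by G predT x y.

Definition represents (G : lgraph) (gens : seq word) : Prop :=
  (nv G = 0 /\ forall w, in_sub gens w -> reduce w = [::]) \/
  (exists v (g : word), v < nv G /\
     forall w, reduced w ->
       ((exists p, walk_end G v p = Some v /\ reduce (walk_label p) = w)
        <-> in_sub gens (reduce (winv g ++ w ++ g)))).

Definition core_of (gens : seq word) (G : lgraph) : Prop :=
  [/\ wf_graph G, folded G, connected G,
      (forall x, x < nv G -> 1 < degree G x) & represents G gens].

Definition sigma_seq (Hs : seq (seq word)) (Gs : seq lgraph) : Prop :=
  size Gs = size Hs /\
  forall i, i < size Hs -> core_of (nth [::] Hs i) (nth G0 Gs i).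

Definition nlab (b : B) (Gs : seq lgraph) : nat :=
  sumn [seq count (fun e => elab e == b) (edges G) | G <- Gs].
Definition total_edges (Gs : seq lgraph) : nat := sumn [seq size (edges G) | G <- Gs].

Definition cplx_le (Hs1 Hs2 : seq (seq word)) : Prop :=
  forall Gs1 Gs2, sigma_seq Hs1 Gs1 -> sigma_seq Hs2 Gs2 ->
    total_edges Gs1 <= total_edges Gs2.

Definition gersten (beta : B -> word) (Hs : seq (seq word)) : Prop :=
  is_aut beta /\ forall a, is_aut a -> cplx_le (aut_act beta Hs) (aut_act a Hs).

Definition wedge (P : {set B}) (G : lgraph) : Prop :=
  exists v, v < nv G /\
    let V1 x := (x == v) || has (fun e => (elab e \in P) && ((esrc e == x) || (etgt e == x))) (edges G) in
    let V2 x := (x == v) || has (fun e => (elab e \notin P) && ((esrc e == x) || (etgt e == x))) (edges G) in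
    [/\ forall x, x < nv G -> V1 x || V2 x,
        forall x, V1 x -> V2 x -> x = v,
        forall x y, V1 x -> V1 y -> conn_by G (fun e => elab e \in P) x y &
        forall x y, V2 x -> V2 y -> conn_by G (fun e => elab e \notin P) x y].

Definition visibly_cleaved (Gs : seq lgraph) : Prop :=
  exists P : {set B}, [/\ P != set0, ~: P != set0 &
    exists i0, [/\ i0 < size Gs, wedge P (nth G0 Gs i0) &
      forall i, i < size Gs -> i != i0 ->
        all (fun e => elab e \in P) (edges (nth G0 Gs i)) \/
        all (fun e => elab e \notin P) (edges (nth G0 Gs i))]].

End FreeGroup.

(* Main.v *)
From HB Require Import structures.
Require Import Defs.
From mathcomp Require Import all_boot.
From mathcomp Require Import boolp zify.
Set Implicit Arguments. Unset Strict Implicit. Unset Printing Implicit Defensive.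

(* A partition of the basis moved by an automorphism, or a single basis
   element moved by an automorphism, is a clopen set X of ends of the Cayley
   tree of F(B) (a sphere in the doubled handlebody): it is encoded by a
   colouring of F(B) that is constant far from the identity ([tame]).  A
   subgroup K crosses X if it has arbitrarily long elements of both colours.
   The vertices of the core graph of H are the cosets Hg such that the
   conjugate of H by g has at least two initial letters, so the number of
   vertices of the core graphs having edges on both sides of a partition
   (D | D^c) of B^{+-1} ([cap D]) counts the cosets crossing the cone on D.
   A Whitehead automorphism replaces n(a) by [cap D] when D contains a but
   not a^-1; hence n(a) <= [cap D] at a Gersten representative.

   Let X be crossed by at most one coset, and look at it from a vertex of the
   tree at which all directions but one, a, are monochromatic, with both
   colours C1 and C2 occurring, where a^-1 is in C2.  Counting vertices with
   the inequality for C2 gives [cap C1 <= 1], provided that no core vertex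
   meets C1 and C2 but not a; when this fails at one such vertex of the tree,
   it holds at another one, seen in the direction a.  As n(b) >= 2 for all b,
   the inequality then forces C1 to be closed under inversion, and C1 is a
   visible cleaving.  Moreover, erasing C1 from X gives a simpler set crossed
   by at most one coset, and does not change the class of X in homology mod 2.
   By induction that class vanishes, so in every basis all n(b) are >= 2:
   this is why the hypothesis on one Gersten representative suffices. *)

(** * The free group on reduced words *)

Section FreeGroupType.
Variable B : finType.
Implicit Types (l m : letter B) (u v w : word B).

Lemma linvK : involutive (@linv B).
Proof. by case=> b s; rewrite /linv /= negbK. Qed.

Lemma linv_neq l : linv l != l.
Proof. by case: l => b s; rewrite /linv xpair_eqE /= andbC; case: s. Qed.

Lemma eq_linv l m : (linv l == m) = (l == linv m).
Proof. by apply/eqP/eqP => [<-|->]; rewrite linvK. Qed.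

Lemma winvK : involutive (@winv B).
Proof. by move=> w; rewrite /winv map_rev revK mapK //; apply: linvK. Qed.

Lemma size_winv w : size (winv w) = size w.
Proof. by rewrite /winv size_rev size_map. Qed.

Lemma winv_cons l w : winv (l :: w) = rcons (winv w) (linv l).
Proof. by rewrite /winv /= rev_cons. Qed.

Lemma winv_rcons l w : winv (rcons w l) = linv l :: winv w.
Proof. by rewrite /winv map_rcons rev_rcons. Qed.

Definition red w := sorted (fun l m => m != linv l) w.

Lemma red_rstep l w : red w -> red (rstep l w).
Proof.
case: w => [//|m w] /= pw; case: ifP => [_|/negbT nm]; last by rewrite /= nm.
exact: path_sorted pw.
Qed.

Lemma red_reduce w : red (reduce w).
Proof. by elim: w => [//|l w IH] /=; apply: red_rstep. Qed.

Lemma rstep_id l w : red (l :: w) -> rstep l w = l :: w.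
Proof. by case: w => [//|m w] /= /andP[/negbTE-> _]. Qed.

Lemma reduce_id w : red w -> reduce w = w.
Proof.
elim: w => [//|l w IH] rw /=; rewrite IH ?rstep_id //.
exact: path_sorted rw.
Qed.

Lemma reducedE w : reduced w = red w.
Proof. by apply/eqP/idP => [<-|/reduce_id//]; apply: red_reduce. Qed.

Lemma reduceK w : reduce (reduce w) = reduce w.
Proof. exact/reduce_id/red_reduce. Qed.

Lemma rstepK l w : red w -> rstep l (rstep (linv l) w) = w.
Proof.
case: w => [|m w] rw /=; first by rewrite eqxx.
rewrite linvK; case: eqP => [e|_] /=; last by rewrite eqxx.
by subst m; apply: rstep_id.
Qed.

Lemma reduce_cat u v : reduce (u ++ v) = foldr (@rstep B) (reduce v) u.
Proof. by rewrite /reduce foldr_cat. Qed.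

Lemma reduce_catr u v : reduce (u ++ reduce v) = reduce (u ++ v).
Proof. by rewrite !reduce_cat reduceK. Qed.

(** By [rstepK] a cancelling pair acts trivially on reduced words, so words act through the free
    group; associativity of the product rests on this. *)
Lemma foldr_reduce u w : red w -> foldr (@rstep B) w (reduce u) = foldr (@rstep B) w u.
Proof.
move=> rw; elim: u => [//|l u IH] /=; rewrite -IH.
case: (reduce u) => [//|m v] /=; case: ifP => [/eqP->|_ //].
rewrite rstepK //; elim: v => [//|k v IHv] /=; exact: red_rstep.
Qed.

Lemma reduce_catl u v : reduce (reduce u ++ v) = reduce (u ++ v).
Proof. by rewrite !reduce_cat foldr_reduce //; apply: red_reduce. Qed.

Lemma reduce_winvl w : reduce (winv w ++ w) = [::].
Proof.
elim: w => [//|l w IH]; rewrite winv_cons cat_rcons.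
rewrite -reduce_catr /= -{2}(linvK l) rstepK ?red_reduce //.
by rewrite -/(reduce w) -[X in _ ++ X]/(reduce w) reduce_catr.
Qed.

Record fg := Fg { fgval : word B; _ : reduced fgval }.
HB.instance Definition _ := [isSub for fgval].
HB.instance Definition _ := [Choice of fg by <:].

Lemma reduced_reduce w : reduced (reduce w).
Proof. by rewrite reducedE red_reduce. Qed.

Definition fgw w : fg := Sub (reduce w) (reduced_reduce w).

Lemma val_fgw w : val (fgw w) = reduce w. Proof. by []. Qed.

Definition fg_mul (g h : fg) : fg := fgw (val g ++ val h).
Definition fg_inv (g : fg) : fg := fgw (winv (val g)).

Lemma valK_fg (g : fg) : fgw (val g) = g.
Proof. by apply: val_inj; rewrite val_fgw; apply/eqP; exact: (valP g). Qed.

Lemma fg_mulA : associative fg_mul.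
Proof.
move=> x y z; apply: val_inj; rewrite /fg_mul /= reduce_catr reduce_catl.
by rewrite catA.
Qed.
Lemma fg_mul1 : left_id (fgw [::]) fg_mul.
Proof. by move=> x; rewrite /fg_mul /= valK_fg. Qed.
Lemma fg_mulr1 : right_id (fgw [::]) fg_mul.
Proof. by move=> x; rewrite /fg_mul /= cats0 valK_fg. Qed.
Lemma fg_mulV : left_inverse (fgw [::]) fg_inv fg_mul.
Proof.
move=> x; apply: val_inj.
by rewrite /fg_mul /fg_inv /= reduce_catl reduce_winvl.
Qed.
Lemma fg_mulrV : right_inverse (fgw [::]) fg_inv fg_mul.
Proof.
move=> x; apply: val_inj; rewrite /fg_mul /fg_inv /= reduce_catr.
by rewrite -{1}(winvK (val x)) reduce_winvl.
Qed.

HB.instance Definition _ := isGroup.Build fg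
  fg_mulA fg_mul1 fg_mulr1 fg_mulV fg_mulrV.

Local Open Scope group_scope.
Implicit Types g h k : fg.

Lemma red_val g : red (val g).
Proof. by rewrite -reducedE; exact: (valP g). Qed.

Lemma fgw_cat u v : fgw (u ++ v) = fgw u * fgw v.
Proof. by apply: val_inj; rewrite /= reduce_catl reduce_catr. Qed.

Lemma fgw_nil : fgw [::] = 1. Proof. by []. Qed.

Lemma fgw_winv w : fgw (winv w) = (fgw w)^-1.
Proof.
apply: (mulIg (fgw w)); rewrite mulVg -fgw_cat; apply: val_inj.
by rewrite val_fgw reduce_winvl.
Qed.

Lemma val_fgw_red w : red w -> val (fgw w) = w.
Proof. exact: reduce_id. Qed.

Lemma red_winv w : red w -> red (winv w).
Proof.
rewrite /red /winv rev_sorted sorted_map.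
by apply: sub_sorted => l m; rewrite /= eq_sym linvK eq_linv.
Qed.

Lemma val_inv g : val g^-1 = winv (val g).
Proof. by rewrite val_fgw_red //; apply/red_winv/red_val. Qed.

Lemma val_mul g h : val (g * h) = reduce (val g ++ val h). Proof. by []. Qed.

Definition lt l : fg := fgw [:: l].

Lemma val_lt l : val (lt l) = [:: l]. Proof. by []. Qed.

Lemma lt_linv l : lt (linv l) = (lt l)^-1.
Proof. by rewrite /lt -fgw_winv. Qed.

Definition len g := size (val g).

Lemma len1 : len 1 = 0. Proof. by []. Qed.
Lemma len_lt l : len (lt l) = 1%N. Proof. by []. Qed.

Lemma len_eq0 g : (len g == 0) = (g == 1).
Proof. by rewrite /len size_eq0. Qed.

Lemma lenV g : len g^-1 = len g.
Proof. by rewrite /len val_inv size_winv. Qed.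

Lemma size_rstep l w : size (rstep l w) <= (size w).+1.
Proof. by case: w => [//|m w] /=; case: ifP => //= _; apply: leqW. Qed.

Lemma len_mul g h : len (g * h) <= len g + len h.
Proof.
rewrite /len val_mul reduce_cat reduce_id ?red_val //.
elim: (val g) => [//|l w IH] /=.
by rewrite (leq_trans (size_rstep _ _)) // addSn ltnS.
Qed.

Lemma len_mul_ge g h : len g <= len (g * h) + len h.
Proof. by rewrite -{1}(mulgK h g) -(lenV h) len_mul. Qed.

Lemma len_mul_gel g h : len h <= len (g * h) + len g.
Proof. by rewrite -{1}(mulKg g h) -(lenV g) addnC len_mul. Qed.

Lemma red_cat u v : red (u ++ v) -> red u /\ red v.
Proof. by case/cat_sorted2. Qed.

Lemma red_cat_cons u l v :
  red u -> red (l :: v) -> (if u is m :: s then last m s != linv l else true) ->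
  red (u ++ l :: v).
Proof.
case: u => [//|m s] /= ru rl nl; rewrite /red /= cat_path /= ru rl andbT.
by rewrite -eq_linv eq_sym.
Qed.

Lemma fgw_cons l w : fgw (l :: w) = lt l * fgw w.
Proof. by rewrite -cat1s fgw_cat. Qed.

Lemma fgw_rcons l w : fgw (rcons w l) = fgw w * lt l.
Proof. by rewrite -cats1 fgw_cat. Qed.

Lemma fg_ind (P : fg -> Prop) :
  P 1 -> (forall g l, P g -> P (g * lt l)) -> forall g, P g.
Proof.
move=> P1 PM g; rewrite -(valK_fg g).
elim/last_ind: (val g) => [//|w l IH]; rewrite fgw_rcons; exact: PM.
Qed.

Lemma val_mul_red g h : red (val g ++ val h) -> val (g * h) = val g ++ val h.
Proof. by move=> r; rewrite val_mul reduce_id. Qed.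

(** Induction on the last letter of [g]: it either meets its inverse at the head of [h] and joins
    [z], or blocks all cancellation. *)
Lemma mul_cancel g h : exists u z v,
  [/\ val g = u ++ z, val h = winv z ++ v & val (g * h) = u ++ v].
Proof.
rewrite -(valK_fg g); have := red_val g; move: (val g) => w.
elim/last_ind: w h => [|w l IH] h rw.
  by exists [::], [::], (val h); rewrite fgw_nil mul1g.
have [rw' _] : red w /\ red [:: l] by apply: red_cat; rewrite cats1.
case hE: (val h) => [|m s].
  exists (rcons w l), [::], [::]; rewrite cats0 val_fgw_red //; split=> //.
  have -> : h = 1 by apply: val_inj.
  by rewrite mulg1 val_fgw_red.
have rh : red (m :: s) by rewrite -hE red_val.
have [em|nm] := eqVneq m (linv l); last first.
  exists (rcons w l), [::], (m :: s); rewrite cats0 val_fgw_red //; split=> //.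
  rewrite val_mul_red val_fgw_red ?hE //; apply: red_cat_cons => //.
  by case: (w) => [|k t] /=; rewrite ?last_rcons eq_sym eq_linv eq_sym eq_sym.
have rs : red s by apply: path_sorted rh.
have [u [z [v [e1 e2 e3]]]] := IH (fgw s) rw'.
rewrite !val_fgw_red // in e1 e2.
exists u, (rcons z l), v; split.
- by rewrite val_fgw_red // e1 -rcons_cat.
- by rewrite winv_rcons /= em e2.
- rewrite -e3 fgw_rcons -mulgA (_ : lt l * h = fgw s) //.
  by rewrite -(valK_fg h) hE em fgw_cons lt_linv mulVKg.
Qed.

End FreeGroupType.

(** * Colourings of the Cayley tree and subgroups *)

Section Cones.
Variable B : finType.
Local Open Scope group_scope.
Implicit Types (l m q : letter B) (g h k p : fg B) (Q : pred (letter B)).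
Implicit Types (X Y : fg B -> bool) (K : fg B -> Prop).

(** The identity gets the colour [false] by convention; crossing only depends on long elements. *)
Definition cone Q g : bool := if val g is l :: _ then Q l else false.

(** An edge of the Cayley tree leads either away from the identity or back toward it. *)
Lemma mul_ltP g l :
  val (g * lt l) = rcons (val g) l \/ val g = rcons (val (g * lt l)) (linv l).
Proof.
have [u [z [v [e1 e2 e3]]]] := mul_cancel g (lt l).
have := e2; rewrite val_lt; case/lastP: z e1 e2 => [|z m] e1 e2.
  by rewrite e3 e1 cats0 => /= <-; left; rewrite cats1.
rewrite winv_rcons => -[em e]; right; rewrite e3 e1.
have := congr1 size e; rewrite size_cat size_winv.
case: (z) (v) => [|k t] [|k' t'] // _.
by rewrite em linvK cats0 cats1.
Qed.

(** The colour can change only across an edge with an endpoint at the identity; the two correction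
    terms are the two orientations of such an edge. *)
Lemma cone_rec Q g l : cone Q (g * lt l) =
  cone Q g (+) ((g == 1) && Q l) (+) ((g * lt l == 1) && Q (linv l)).
Proof.
have e h : (h == 1) = (val h == [::]) by [].
rewrite !e /cone; case: (mul_ltP g l) => ->.
  by case: (val g) => [|m [|k s]] /=; rewrite ?addbF ?addFb ?andbF ?addbF.
by case: (val (g * lt l)) => [|m s] /=; rewrite ?addbF ?addFb ?addbb.
Qed.

(* A colouring is determined by the edges of the Cayley tree across which it changes. *)
Lemma cone_unique Q Y : Y 1 = false ->
  (forall g l, Y (g * lt l) =
     Y g (+) ((g == 1) && Q l) (+) ((g * lt l == 1) && Q (linv l))) ->
  Y =1 cone Q.
Proof. by move=> Y1 Yr; elim/fg_ind => [//|g l IH]; rewrite Yr IH cone_rec. Qed.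

(** A factor [h] cancels at most [len h] letters. *)
Lemma mul_keep_prefix g h (p r : word B) : val g = p ++ r -> len h <= size r ->
  exists s, val (g * h) = p ++ s.
Proof.
have [u [z [v [e1 e2 e3]]]] := mul_cancel g h; rewrite e1 => e hr.
have hz : size z <= size r.
  by apply: leq_trans hr; rewrite /len e2 size_cat size_winv leq_addr.
have hp : size p <= size u.
  move/(congr1 size): e; rewrite !size_cat => e.
  by rewrite -(leq_add2r (size r)) -e leq_add2l.
exists (drop (size p) u ++ v); rewrite e3 catA.
suff ep : p = take (size p) u by rewrite {1}ep cat_take_drop.
by move/(congr1 (take (size p))): e; rewrite takel_cat // take_size_cat // => ->.
Qed.

Lemma len_mull_ge M g k : M + len g <= len k -> M <= len (g * k).
Proof. by have := len_mul_gel g k; lia. Qed.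

Lemma len_mulr_ge M g k : M + len k <= len g -> M <= len (g * k).
Proof. by have := len_mul_ge g k; lia. Qed.

Lemma len_conj_ge M g k h : M + len g + len h <= len k -> M <= len (g * k * h).
Proof. by have := len_mul_ge (g * k) h; have := len_mul_gel g k; lia. Qed.

Lemma head_mul g h l w : val g = l :: w -> len h <= size w ->
  exists s, val (g * h) = l :: s.
Proof. exact: (@mul_keep_prefix g h [:: l] w). Qed.

Lemma val_mul_ext g h (u s : word B) l m : val g = rcons u m -> val h = l :: s ->
  l != linv m -> val (g * h) = rcons u m ++ l :: s.
Proof.
move=> eg eh nl; rewrite val_mul_red eg eh //; apply: red_cat_cons.
- by rewrite -eg red_val.
- by rewrite -eh red_val.
by case: (u) => [|n t] /=; rewrite ?last_rcons -eq_linv eq_sym.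
Qed.

(** * Colourings of the ends of the Cayley tree *)

Definition tameN N X := forall g l, N <= len g -> X (g * lt l) = X g.
Definition tame X := exists N, tameN N X.

Lemma tameN_mul N X g h : tameN N X -> N + len h <= len g -> X (g * h) = X g.
Proof.
move=> tX; rewrite -{2}(valK_fg h) /len.
elim: (val h) g => [|l w IH] g /= lg; first by rewrite fgw_nil mulg1.
rewrite fgw_cons mulgA IH ?tX //; first by apply: leq_trans lg; rewrite leq_addr.
have := len_mul_ge g (lt l); rewrite len_lt addn1 => lg'.
by have := leq_trans lg lg'; rewrite addnS ltnS.
Qed.

(** The path from [p] to [g] in the tree stays at distance at least [N] from the identity, where the
    colour is constant along edges. *)
Lemma tameN_prefix N X g (p r : word B) : tameN N X -> val g = p ++ r -> N <= size p ->
  X g = X (fgw p).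
Proof.
move=> tX; have := red_val g; rewrite -{3}(valK_fg g) => + e; rewrite e => {g e}.
move=> rg lp; elim/last_ind: r rg => [|r l IH] rg; first by rewrite cats0.
rewrite -rcons_cat in rg *; rewrite fgw_rcons.
have [rg' _] : red (p ++ r) /\ red [:: l] by apply: red_cat; rewrite cats1.
by rewrite tX ?IH // /len val_fgw_red // size_cat (leq_trans lp) // leq_addr.
Qed.

Lemma tame_cone Q : tame (cone Q).
Proof.
exists 2 => g l lg; rewrite cone_rec.
have -> : (g == 1) = false by rewrite -len_eq0; case: (len g) lg.
have -> : (g * lt l == 1) = false.
  rewrite -len_eq0; have := leq_trans lg (len_mul_ge g (lt l)).
  by rewrite len_lt addn1 ltnS; case: (len _).
by rewrite !addbF.
Qed.

Lemma tame_translate X y : tame X -> tame (fun w => X (y * w)).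
Proof.
move=> [N tX]; exists (N + len y) => g l lg; rewrite mulgA tX //.
by have := leq_trans lg (len_mul_gel y g); rewrite leq_add2r.
Qed.

Lemma tame_neg X : tame X -> tame (fun w => ~~ X w).
Proof. by move=> [N tX]; exists N => g l lg; rewrite tX. Qed.

Lemma tame_and X Y : tame X -> tame Y -> tame (fun w => X w && Y w).
Proof.
move=> [N tX] [N' tY]; exists (maxn N N') => g l; rewrite geq_max => /andP[l1 l2].
by rewrite tX ?tY.
Qed.

Definition subgroup K :=
  [/\ K 1, forall g h, K g -> K h -> K (g * h) & forall g, K g -> K g^-1].

(** This is [g^-1 K g], the group seen from the vertex [g]; by [sconj_mem] it depends only on the
    coset [K g]. *)
Definition sconj K g : fg B -> Prop := fun k => K (g * k * g^-1).

Lemma sconjM K g h : sconj (sconj K g) h = sconj K (g * h).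
Proof. by apply: funext => k; rewrite /sconj invgM !mulgA. Qed.

Lemma sconj1 K : sconj K 1 = K.
Proof. by apply: funext => k; rewrite /sconj invg1 mulg1 mul1g. Qed.

Lemma subgroup_sconj K g : subgroup K -> subgroup (sconj K g).
Proof.
case=> K1 KM KV; split; rewrite /sconj; first by rewrite mulg1 mulgV.
  by move=> h k Kh Kk; have := KM _ _ Kh Kk; rewrite !mulgA mulgVK.
by move=> h /KV; rewrite !invgM invgK mulgA.
Qed.

Lemma sconj_mem K g k : subgroup K -> K k -> sconj K (k * g) = sconj K g.
Proof.
move=> [K1 KM KV] Kk; apply: funext => h; rewrite /sconj invgM.
have -> : k * g * h * (g^-1 * k^-1) = k * (g * h * g^-1) * k^-1 by rewrite !mulgA.
apply: propext; split=> H; last by apply/KM/KV/Kk; apply: KM.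
have := KM _ _ (KM _ _ (KV _ Kk) H) Kk.
by rewrite -!mulgA mulVg mulg1 mulKg.
Qed.

(** For tame [X] this says that the limit set of [K] meets the ends coloured by [X], without
    introducing ends. *)
Definition meets K X := forall M, exists k, [/\ K k, M <= len k & X k].
Definition crosses K X := meets K X /\ meets K (fun w => ~~ X w).
Definition star K l := meets K (cone (pred1 l)).
(** Equivalently, the identity lies on the subtree spanned by the limit set of [K]. *)
Definition big K := exists l m, [/\ l != m, star K l & star K m].

Lemma starP K l : star K l <->
  forall M, exists k s, [/\ K k, M <= len k & val k = l :: s].
Proof.
split=> H M; have [k] := H M.
  case=> Kk Mk; rewrite /cone; case E: (val k) => [|m s] //= /eqP e.
  by subst m; exists k, s.
by case=> s [Kk Mk e]; exists k; rewrite /cone e /= eqxx.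
Qed.

Lemma meets_mono N K X Y : (forall g, N <= len g -> X g -> Y g) ->
  meets K X -> meets K Y.
Proof.
move=> XY H M; have [k [Kk]] := H (maxn M N); rewrite geq_max => /andP[lM lN] Xk.
by exists k; split=> //; apply: XY.
Qed.

Lemma meets_or K X Y : meets K (fun w => X w || Y w) -> meets K X \/ meets K Y.
Proof.
move=> H; have [|nX] := pselect (meets K X); [by left | right].
have [M nM] : exists M, forall k, K k -> M <= len k -> X k -> False.
  have /existsNP[M nM] := nX; exists M => k Kk lk Xk; apply: nM; by exists k.
move=> M'; have [k [Kk]] := H (maxn M M'); rewrite geq_max => /andP[lM lN].
by case/orP=> Xk; [case: (nM k) | exists k].
Qed.

Lemma fin_bound (T : finType) (P : T -> nat -> Prop) :
  (forall t, exists M, forall n, M <= n -> P t n) ->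
  exists M, forall t n, M <= n -> P t n.
Proof.
move=> /choice[f fP]; exists (\max_t f t) => t n le.
by apply: fP; apply: leq_trans le; apply: (leq_bigmax t).
Qed.

Lemma meets_cone K Q : meets K (cone Q) -> exists2 l, Q l & star K l.
Proof.
move=> H; apply: contrapT => no.
have [l|M HM] := @fin_bound (letter B)
  (fun l M => Q l -> forall k s, K k -> M <= len k -> val k = l :: s -> False).
  have [Ql|nQ] := boolP (Q l); last by exists 0 => n _ Ql; case/negP: nQ.
  have /existsNP[M nM] : ~ star K l by move=> sl; apply: no; exists l.
  exists M => n le _ k s Kk lk e; apply: nM; exists k.
  by rewrite (leq_trans le) // /cone e /= eqxx.
have [k [Kk lk]] := H M; rewrite /cone; case E: (val k) => [//|l s] Ql.
exact: HM (leqnn M) Ql _ _ Kk lk E.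
Qed.

Lemma star_cone K Q l : Q l -> star K l -> meets K (cone Q).
Proof.
move=> Ql; apply: (@meets_mono 0) => g _; rewrite /cone.
by case: (val g) => [//|m s] /= /eqP->.
Qed.

Lemma crosses_big K Q : crosses K (cone Q) ->
  exists l m, [/\ Q l, ~~ Q m, star K l & star K m].
Proof.
case=> /meets_cone[l Ql sl] H.
have [m nm sm] : exists2 m, (predC Q) m & star K m.
  apply: meets_cone; apply: (@meets_mono 1) H => g.
  by rewrite /len /cone; case: (val g).
by exists l, m.
Qed.

(** Seen from [y], conjugation by [y] only changes a long element by a factor [y] on the right,
    which tameness makes invisible. *)
Lemma meets_sconj K X y : tame X ->
  meets (sconj K y) (fun w => X (y * w)) <-> meets K X.
Proof.
move=> [N tX]; split=> H M.
  (* Conjugating costs up to [2 * len y] letters; the third [len y] lets tameness absorb the final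
     factor [y]. *)
  have [k [Kk lk Xk]] := H (M + N + 3 * len y)%N.
  have lk' : (M + N + len y)%N <= len (y * k * y^-1).
    by apply: len_conj_ge; rewrite lenV; lia.
  exists (y * k * y^-1); split=> //.
    by apply: leq_trans lk'; rewrite -addnA leq_addr.
  rewrite -(@tameN_mul N X _ y) //; first by rewrite mulgVK.
  by apply: leq_trans lk'; rewrite -addnA leq_addl.
have [k [Kk lk Xk]] := H (M + N + 2 * len y)%N.
exists (y^-1 * k * y); split.
- by rewrite /sconj !mulgA mulgK mulgV mul1g.
- by apply: len_conj_ge; rewrite lenV; lia.
by rewrite !mulgA mulgV mul1g (@tameN_mul N) //; lia.
Qed.

Lemma crosses_sconj K X y : tame X ->
  crosses (sconj K y) (fun w => X (y * w)) <-> crosses K X.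
Proof.
move=> tX; rewrite /crosses meets_sconj //.
by rewrite (meets_sconj K y (tame_neg tX)).
Qed.

Lemma val_divl p k (p0 s : word B) l m : val p = rcons p0 m -> val k = l :: s ->
  head m p0 != l -> val (p^-1 * k) = linv m :: (winv p0 ++ l :: s).
Proof.
move=> ep ek hl; rewrite val_mul_red val_inv ep winv_rcons ek //.
apply: red_cat_cons; rewrite -?ek ?red_val //.
  by rewrite -winv_rcons -ep -val_inv red_val.
case: p0 hl {ep} => [|n t] /=; first by rewrite eq_linv linvK.
by rewrite winv_cons last_rcons eq_linv linvK.
Qed.

(** [head m p0] is the first letter of [p]. Since [l] differs from it, the direction [l] at the
    identity is seen from [p] by going back through the last letter of [p]. *)
Lemma star_sconj_last K l p (p0 : word B) m : star K l -> val p = rcons p0 m ->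
  head m p0 != l -> star (sconj K p) (linv m).
Proof.
move=> /starP sl ep hl; apply/starP => M.
have [k [s [Kk lk ek]]] := sl (M + len p + len p).+1.
have e1 := val_divl ep ek hl.
have lk1 : (M + len p).+1 <= len (p^-1 * k).
  by apply: len_mull_ge; rewrite lenV; lia.
have [|t et] := @head_mul (p^-1 * k) p _ _ e1.
  by move: lk1; rewrite [len (_ * _)]/len e1 /= ltnS; apply: leq_trans; apply: leq_addl.
exists (p^-1 * k * p), t; split=> //.
  by rewrite /sconj !mulgA mulgK mulgV mul1g.
by apply: len_conj_ge; rewrite lenV; lia.
Qed.

Lemma star_prefix K u q : star (sconj K u) q -> red (rcons (val u) q) ->
  exists k s, K k /\ val k = rcons (val u) q ++ s.
Proof.
move=> /starP/(_ (len u).+1)[k [s [Kk lk ek]]] r.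
have e1 : val (u * k) = rcons (val u) q ++ s.
  rewrite cat_rcons -ek val_mul_red // ek.
  apply: red_cat_cons; rewrite -?ek ?red_val //.
  case: (val u) r => [//|n t] /=; rewrite rcons_path => /andP[_].
  by rewrite -eq_linv eq_sym.
have [|t et] := @mul_keep_prefix (u * k) u^-1 _ _ e1.
  by rewrite lenV; move: lk; rewrite /len ek.
by exists (u * k * u^-1), t.
Qed.

(** Of two directions at [u], at least one does not lead back toward the identity, so an element of
    [K] passes through [u] and beyond. *)
Lemma big_prefix K u : big (sconj K u) ->
  exists q k s, K k /\ val k = rcons (val u) q ++ s.
Proof.
move=> [l [m [ne sl sm]]].
have [q [sq rq]] : exists q, star (sconj K u) q /\ red (rcons (val u) q).
  have ru := red_val u; case eu: (val u) ru => [|n t] ru.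
    by exists l.
  have [e|ne'] := eqVneq l (linv (last n t)).
    by exists m; split=> //; rewrite /red /= rcons_path -e eq_sym ne andbT.
  by exists l; split=> //; rewrite /red /= rcons_path ne' andbT.
by exists q; exact: star_prefix sq rq.
Qed.

Lemma big_conj_last K p (p0 : word B) m : big K -> val p = rcons p0 m ->
  star (sconj K p) (linv m).
Proof.
move=> [l [l' [nl sl sl']]] e.
have [el|ne] := eqVneq (head m p0) l; last exact: star_sconj_last sl e ne.
by apply: star_sconj_last sl' e _; rewrite el.
Qed.

(** From a vertex between two such vertices, one direction leads back to the first and another on to
    the second, and the group has long elements in both. *)
Lemma big_convex K (p q : word B) : red (p ++ q) -> big K -> big (sconj K (fgw (p ++ q))) ->
  big (sconj K (fgw p)).
Proof.
case/lastP: p => [|p m]; first by rewrite fgw_nil sconj1.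
case: q => [|l q]; first by rewrite cats0.
move=> r b1 b2; have [rp rq] := red_cat r.
exists (linv m), l; split.
- move: r; rewrite cat_rcons => /red_cat[_] /= /andP[+ _].
  by rewrite eq_sym.
- by apply: big_conj_last b1 _; rewrite val_fgw_red.
have := @big_conj_last _ (fgw (winv (l :: q))) (winv q) (linv l) b2.
rewrite linvK val_fgw_red ?red_winv // winv_cons => /(_ erefl).
by rewrite sconjM fgw_cat -winv_cons fgw_winv mulgK.
Qed.

Lemma cyc_pow k l s : val k = l :: s -> last l s != linv l ->
  forall n, exists t, val (k ^+ n.+1) = l :: t /\ n <= len (k ^+ n.+1).
Proof.
move=> ek nl; elim=> [|n [t [e le]]]; first by exists s; rewrite expg1.
have e1 : val (k ^+ n.+2) = l :: (s ++ l :: t).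
  rewrite expgS val_mul_red ek e //; apply: red_cat_cons => //.
    by rewrite -ek red_val.
  by rewrite -e red_val.
by exists (s ++ l :: t); split=> //; move: le; rewrite /len e1 e /= size_cat /=; lia.
Qed.

(** A nontrivial element has an axis: conjugation by its first letter shortens it until it is
    cyclically reduced, and then its positive and negative powers start with different letters. *)
Lemma exists_big K k : subgroup K -> K k -> k != 1 -> exists g, big (sconj K g).
Proof.
move=> sK; have [n] := ubnP (len k); elim: n => // n IH in K k sK *.
move=> lk Kk k1; case ek: (val k) => [|l s].
  by case/eqP: k1; apply: val_inj.
have KX n' k' : K k' -> K (k' ^+ n').
  by case: sK => K1 KM _; elim: n' => [//|n' IH'] Kk'; rewrite expgS; apply: KM; auto.
have [nl|/negbNE/eqP el] := boolP (last l s != linv l); last first.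
  case/lastP: s ek el => [|s m] ek /= el.
    by have := linv_neq l; rewrite -el eqxx.
  rewrite last_rcons in el; subst m.
  pose k' := (lt l)^-1 * k * lt l.
  have rk := red_val k; rewrite ek in rk.
  have rs : red s by move: rk; rewrite -cat1s -cats1 => /red_cat[_] /red_cat[].
  have ek' : k' = fgw s.
    by rewrite /k' -(valK_fg k) ek fgw_cons fgw_rcons lt_linv mulKg mulgVK.
  have [||||g bg] := IH (sconj K (lt l)) k'.
  - exact: subgroup_sconj.
  - rewrite ek' /len val_fgw_red //; move: lk; rewrite /len ek /= size_rcons.
    by rewrite ltnS; apply: leq_trans; apply: leqW.
  - by rewrite /sconj /k' !mulgA mulgK mulgV mul1g.
  - have ke : k = lt l * k' * (lt l)^-1 by rewrite /k' !mulgA mulgK mulgV mul1g.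
    by apply: contra_neq k1 => e; rewrite ke e mulg1 mulgV.
  by exists (lt l * g); rewrite -sconjM.
have KV : K k^-1 by case: sK => _ _; apply.
case/lastP: s ek nl => [|s m] ek nl.
  exists 1; rewrite sconj1; exists l, (linv l); rewrite eq_sym linv_neq; split=> //.
    apply/starP => M; have [t [e lM]] := cyc_pow ek nl M.
    by exists (k ^+ M.+1), t; split; auto.
  apply/starP => M; have [||t [e lM]] := @cyc_pow k^-1 (linv l) [::] _ _ M.
  - by rewrite val_inv ek.
  - by rewrite linvK /= linv_neq.
  by exists (k^-1 ^+ M.+1), t; split; auto.
rewrite last_rcons in nl.
exists 1; rewrite sconj1; exists l, (linv m); split.
- by rewrite eq_sym eq_linv.
- apply/starP => M; have [|t [e lM]] := cyc_pow ek _ M; first by rewrite last_rcons.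
  by exists (k ^+ M.+1), t; split; auto.
apply/starP => M; have [||t [e lM]] := @cyc_pow k^-1 (linv m) (winv (l :: s)) _ _ M.
- by rewrite val_inv ek -rcons_cons winv_rcons.
- by rewrite winv_cons last_rcons linvK eq_sym.
by exists (k^-1 ^+ M.+1), t; split; auto.
Qed.

Definition auto (f f' : fg B -> fg B) :=
  [/\ {morph f : g h / g * h}, {morph f' : g h / g * h}, cancel f f' & cancel f' f].

Lemma auto_sym f f' : auto f f' -> auto f' f.
Proof. by case. Qed.

Lemma morph1 (f : fg B -> fg B) : {morph f : g h / g * h} -> f 1 = 1.
Proof. by move=> fM; apply: (mulgI (f 1)); rewrite -fM !mulg1. Qed.

Lemma morphV (f : fg B -> fg B) : {morph f : g h / g * h} -> {morph f : g / g^-1}.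
Proof. by move=> fM g; apply: (mulgI (f g)); rewrite -fM !mulgV morph1. Qed.

Lemma morph_len (f : fg B -> fg B) : {morph f : g h / g * h} ->
  exists M, forall g, len (f g) <= M * len g.
Proof.
move=> fM; exists (\max_l len (f (lt l))) => g; rewrite -{1}(valK_fg g) /len.
elim: (val g) => [|l w IH]; first by rewrite fgw_nil morph1.
rewrite fgw_cons fM mulnS (leq_trans (len_mul _ _)) // leq_add //.
exact: (leq_bigmax l).
Qed.

(** The inverse stretches lengths by a bounded factor, so a long element cannot have a short
    image. *)
Lemma auto_long f f' : auto f f' ->
  forall M, exists N, forall g, N <= len g -> M <= len (f g).
Proof.
case=> fM f'M fK f'K M; have [M' HM'] := morph_len f'M.
exists (M' * M).+1 => g lg; rewrite leqNgt; apply/negP => lt.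
have := HM' (f g); rewrite fK => le; have := leq_trans lg le.
by rewrite ltnNge leq_mul2l (ltnW lt) orbT.
Qed.

Lemma tame_auto f f' X : auto f f' -> tame X -> tame (fun w => X (f w)).
Proof.
move=> af [N tX]; have [fM _ _ _] := af.
have [M HM] := morph_len fM.
have [N' HN'] := auto_long af (N + M).
exists N' => g l /HN' lg; rewrite fM (@tameN_mul N) //; apply: leq_trans lg.
by rewrite leq_add2l (leq_trans (HM _)) // len_lt muln1.
Qed.

(** [fun k => K (f' k)] is the image of [K] under [f]; long elements stay long in both directions by
    [auto_long]. *)
Lemma meets_auto f f' K X : auto f f' ->
  meets (fun k => K (f' k)) X <-> meets K (fun w => X (f w)).
Proof.
move=> af; have [fM f'M fK f'K] := af; split=> H M.
  have [N HN] := auto_long (auto_sym af) M.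
  have [k [Kk lk Xk]] := H N; exists (f' k); rewrite f'K; split=> //; exact: HN.
have [N HN] := auto_long af M.
have [k [Kk lk Xk]] := H N; exists (f k); rewrite fK; split=> //; exact: HN.
Qed.

Lemma crosses_auto f f' K X g : auto f f' ->
  crosses (sconj (fun k => K (f' k)) g) X <->
  crosses (sconj K (f' g)) (fun w => X (f w)).
Proof.
move=> af; have [fM f'M fK f'K] := af.
have -> : sconj (fun k => K (f' k)) g = fun k => sconj K (f' g) (f' k).
  by apply: funext => k; rewrite /sconj !f'M (morphV f'M).
by rewrite /crosses !(meets_auto _ _ af).
Qed.

End Cones.

(** * Core graphs as sets of cosets *)

Section Reading.
Variable B : finType.
Local Open Scope group_scope.
Implicit Types (l m q : letter B) (g h k : fg B) (u v w : word B).
Implicit Types (G : lgraph B) (K : fg B -> Prop).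

Definition step G x l y : bool :=
  (if l.2 then (y, l.1, x) else (x, l.1, y)) \in edges G.

Fixpoint rd G x w y : Prop :=
  if w is l :: w' then exists z, step G x l z /\ rd G z w' y else x = y.

Lemma walk_end_None G p : foldl (wstep G) None p = None.
Proof. by elim: p. Qed.

Lemma wstepP G x s y : wstep G (Some x) s = Some y <->
  s = (if s.2 then (y, elab s.1, x) else (x, elab s.1, y), s.2)
  /\ step G x (elab s.1, s.2) y.
Proof.
case: s => -[[a b] c] t; rewrite /wstep /step /elab /esrc /etgt /=.
case: t => /=; split.
- by case: ifP => // ein; case: eqP => // <- [<-].
- by case=> -[-> ->] ->; rewrite eqxx.
- by case: ifP => // ein; case: eqP => // <- [<-].
- by case=> -[-> ->] ->; rewrite eqxx.
Qed.

Lemma rdP G x w y : rd G x w y <->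
  exists p, walk_end G x p = Some y /\ walk_label p = w.
Proof.
elim: w x => [|l w IH] x /=.
  split=> [->|[[|s p] [e //]]]; first by exists [::].
  by case: e.
split=> [[z [st /IH[p [e1 e2]]]]|[[|s p] [// e [el ew]]]].
  exists ((if l.2 then (z, l.1, x) else (x, l.1, z), l.2) :: p); split.
    rewrite /walk_end /= -e1 /walk_end; congr (foldl _ _ p).
    by case: l st => b [] /=; rewrite /step /= => ->; rewrite /esrc /etgt /= eqxx.
  by rewrite /= e2; case: (l) => b [].
have {}e : foldl (wstep G) (wstep G (Some x) s) p = Some y := e.
case E: (wstep G (Some x) s) e => [z|] e; last by rewrite walk_end_None in e.
exists z; have [_] := (wstepP _ _ _ _).1 E; rewrite el => st; split=> //.
by apply/IH; exists p.
Qed.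

Lemma rd_cat G x u v y : rd G x (u ++ v) y <-> exists z, rd G x u z /\ rd G z v y.
Proof.
elim: u x => [|l u IH] x /=.
  by split=> [H|[z [-> //]]]; exists x.
split=> [[z [st /IH[t [r1 r2]]]]|[t [[z [st r1]] r2]]].
  by exists t; split=> //; exists z.
by exists z; split=> //; apply/IH; exists t.
Qed.

Lemma step_linv G x l y : step G x (linv l) y = step G y l x.
Proof. by case: l => b []. Qed.

Lemma rd_winv G x w y : rd G x w y -> rd G y (winv w) x.
Proof.
elim: w x => [|l w IH] x /=; first by move->.
case=> z [st /IH r]; rewrite winv_cons -cats1; apply/rd_cat; exists z; split=> //.
by exists x; rewrite step_linv.
Qed.

Lemma step_det G x l y z : folded G -> step G x l y -> step G x l z -> y = z.
Proof.
case=> _ fd; rewrite /step; case: l => b [] /= s1 s2.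
  have [[]//|ne] := eqVneq (y, b, x) (z, b, x).
  by case: (fd _ _ s1 s2 ne); rewrite /elab /esrc /etgt /= eqxx //; case.
have [[]//|ne] := eqVneq (x, b, y) (x, b, z).
by case: (fd _ _ s1 s2 ne); rewrite /elab /esrc /etgt /= eqxx //; case.
Qed.

Lemma rd_det G x w y z : folded G -> rd G x w y -> rd G x w z -> y = z.
Proof.
move=> fd; elim: w x => [|l w IH] x /=; first by move=> -> ->.
case=> t [s1 r1] [t' [s2 r2]]; rewrite (step_det fd s1 s2) in r1.
exact: IH r1 r2.
Qed.

(** Foldedness makes each step deterministic, so reading a cancelling pair returns to the starting
    vertex. *)
Lemma rd_reduce G x w y : folded G -> rd G x w y -> rd G x (reduce w) y.
Proof.
move=> fd; elim: w x => [//|l w IH] x /= [z [st /IH]].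
rewrite -/(reduce w); case: (reduce w) => [|m v] /= r; first by exists z.
case: r => t [s2 r]; case: eqP => [em|_]; last by exists z; split=> //; exists t.
by subst m; rewrite -step_linv in st; rewrite (step_det fd st s2).
Qed.

Lemma step_wf G x l y : wf_graph G -> step G x l y -> x < nv G /\ y < nv G.
Proof.
move=> /allP wf; rewrite /step.
by case: ifP => _ /wf; rewrite /esrc /etgt /= => /andP[].
Qed.

Definition rdg G x g y := rd G x (val g) y.

Lemma rdg_fgw G x w y : folded G -> rd G x w y -> rdg G x (fgw w) y.
Proof. by move=> fd r; rewrite /rdg val_fgw; apply: rd_reduce. Qed.

Lemma rdg_mul G x g y h z : folded G -> rdg G x g y -> rdg G y h z ->
  rdg G x (g * h) z.
Proof. by move=> fd r1 r2; apply: rd_reduce => //; apply/rd_cat; exists y. Qed.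

Lemma rdgV G x g y : rdg G x g y -> rdg G y g^-1 x.
Proof. by rewrite /rdg val_inv; apply: rd_winv. Qed.

Lemma rdg_det G x g y z : folded G -> rdg G x g y -> rdg G x g z -> y = z.
Proof. exact: rd_det. Qed.

Definition starb G x l : bool :=
  has (fun e => (elab e == l.1) && ((if l.2 then etgt e else esrc e) == x)) (edges G).

Lemma starbP G x l : starb G x l <-> exists y, step G x l y.
Proof.
split=> [/hasP[[[a b] c] ein]|[y st]]; rewrite /elab /esrc /etgt /=.
  case: l => b' [] /= /andP[/eqP<- /eqP<-]; first by exists a.
  by exists c.
apply/hasP; exists (if l.2 then (y, l.1, x) else (x, l.1, y)) => //.
by rewrite /elab /esrc /etgt; case: l {st} => b [] /=; rewrite !eqxx.
Qed.

Lemma count_gt1 (T : eqType) (a : pred T) (s : seq T) : uniq s -> 1 < count a s ->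
  exists e1 e2, [/\ e1 != e2, e1 \in s, e2 \in s, a e1 & a e2].
Proof.
rewrite -size_filter => us.
have := filter_uniq a us; have := mem_filter a _ s.
case: (filter a s) => [|e1 [|e2 t]] // mf /= /andP[+ _] _.
rewrite inE negb_or => /andP[ne _].
have /andP[a1 i1] : a e1 && (e1 \in s) by rewrite -mf inE eqxx.
have /andP[a2 i2] : a e2 && (e2 \in s) by rewrite -mf !inE eqxx orbT.
by exists e1, e2.
Qed.

(** Foldedness gives different letters to two edges leaving, or two edges entering, the same vertex;
    one edge of each kind, possibly the same loop, gives letters of opposite orientation. *)
Lemma degree_letters G x : folded G -> 1 < degree G x ->
  exists l m, [/\ l != m, starb G x l & starb G x m].
Proof.
case=> ue fd; rewrite /degree => dg.
have [c1|] := ltnP 1 (count (fun e => esrc e == x) (edges G)).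
  have [e1 [e2 [ne i1 i2 /eqP s1 /eqP s2]]] := count_gt1 ue c1.
  exists (elab e1, false), (elab e2, false); split.
  - by case: (fd _ _ i1 i2 ne) => [ne'|[]]; rewrite ?s1 ?s2 ?eqxx // xpair_eqE negb_and ne'.
  - by apply/hasP; exists e1; rewrite //= s1 !eqxx.
  - by apply/hasP; exists e2; rewrite //= s2 !eqxx.
have [c1 _|] := ltnP 1 (count (fun e => etgt e == x) (edges G)).
  have [e1 [e2 [ne i1 i2 /eqP s1 /eqP s2]]] := count_gt1 ue c1.
  exists (elab e1, true), (elab e2, true); split.
  - by case: (fd _ _ i1 i2 ne) => [ne'|[]]; rewrite ?s1 ?s2 ?eqxx // xpair_eqE negb_and ne'.
  - by apply/hasP; exists e1; rewrite //= s1 !eqxx.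
  - by apply/hasP; exists e2; rewrite //= s2 !eqxx.
move=> c2 c1.
have /hasP[e1 i1 /eqP s1] : has (fun e => esrc e == x) (edges G) by rewrite has_count; lia.
have /hasP[e2 i2 /eqP s2] : has (fun e => etgt e == x) (edges G) by rewrite has_count; lia.
exists (elab e1, false), (elab e2, true); split; first by rewrite xpair_eqE andbF.
- by apply/hasP; exists e1; rewrite //= s1 !eqxx.
- by apply/hasP; exists e2; rewrite //= s2 !eqxx.
Qed.

(** There is no dead end: of two letters readable at a vertex, one is not the inverse of the letter
    just read. *)
Lemma extend_reading G x l : wf_graph G -> folded G ->
  (forall z, z < nv G -> 1 < degree G z) -> starb G x l ->
  forall n, exists w y, [/\ red (l :: w), size w = n, rd G x (l :: w) y & y < nv G].
Proof.
move=> wf fd dg /starbP[y0 st0]; elim=> [|n [w [y [rw sw r ly]]]].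
  exists [::], y0; split=> //; first by exists y0.
  by case: (step_wf wf st0).
have [m [m' [ne s1 s2]]] := degree_letters fd (dg y ly).
have [m0 [nm0 s0]] : exists m0, m0 != linv (last l w) /\ starb G y m0.
  have [e|ne'] := eqVneq m (linv (last l w)); last by exists m.
  by exists m'; split=> //; rewrite -e eq_sym.
have [z st] := (starbP _ _ _).1 s0.
exists (rcons w m0), z; split.
- by move: rw; rewrite /red /= rcons_path => ->.
- by rewrite size_rcons sw.
- rewrite -rcons_cons -cats1; apply/rd_cat; exists y; split=> //.
  by exists z.
- by case: (step_wf wf st).
Qed.

Lemma nat_bound (P : nat -> nat -> Prop) n :
  (forall y, y < n -> exists M, P y M) ->
  exists M, forall y, y < n -> exists2 M', M' <= M & P y M'.
Proof.
elim: n => [|n IH] H; first by exists 0.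
have [M HM] := IH (fun y ly => H y (ltnW ly)); have [M' HM'] := H n (leqnn _).
exists (M + M') => y; rewrite ltnS leq_eqVlt => /orP[/eqP->|/HM[M2 le P2]].
  by exists M' => //; lia.
by exists M2 => //; lia.
Qed.

(* The core is finite, so a long reduced reading closes up by a word of bounded length. *)
Lemma star_of_starb G x l : wf_graph G -> folded G -> connected G ->
  (forall z, z < nv G -> 1 < degree G z) -> starb G x l ->
  star (fun k => rdg G x k x) l.
Proof.
move=> wf fd cn dg sl; have [y0 st0] := (starbP _ _ _).1 sl.
have [lx _] := step_wf wf st0.
have [M HM] : exists M, forall y, y < nv G ->
    exists2 M', M' <= M & exists2 u, rd G y u x & size u = M'.
  apply: nat_bound => y ly; have [p [_ e]] := cn y x ly lx.
  by exists (size (walk_label p)), (walk_label p) => //; apply/rdP; exists p.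
apply/starP => N; have [w [y [rw sw r ly]]] := extend_reading wf fd dg sl (N + M).
have [M' le [u ru su]] := HM y ly.
have lu : len (fgw u) <= M.
  apply: leq_trans le; rewrite -su /len val_fgw.
  by elim: (u) => [//|m t IH] /=; apply: leq_trans (size_rstep _ _) _.
have e1 : val (fgw (l :: w)) = l :: w by rewrite val_fgw_red.
have [|s es] := @head_mul _ (fgw (l :: w)) (fgw u) l w e1; first by rewrite sw; lia.
exists (fgw (l :: w) * fgw u), s; split=> //.
  by apply: (@rdg_mul _ _ _ y) => //; apply: rdg_fgw.
by apply: len_mulr_ge; rewrite {2}/len e1 /= sw; lia.
Qed.

Definition Ksub (gens : seq (word B)) g : Prop := in_sub gens (val g).

Definition gval (gens : seq (word B)) (x : nat * bool) : fg B :=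
  if x.2 then (fgw (nth [::] gens x.1))^-1 else fgw (nth [::] gens x.1).

Lemma fgw_flatten_gval gens s :
  fgw (flatten [seq if x.2 then winv (nth [::] gens x.1) else nth [::] gens x.1 | x <- s])
  = foldr (fun x g => gval gens x * g) 1 s.
Proof.
elim: s => [//|[i b] s IH] /=; rewrite fgw_cat IH; congr (_ * _).
by case: b; rewrite /gval /= ?fgw_winv.
Qed.

Lemma in_subE gens w : in_sub gens w <-> exists s,
  all (fun x => x.1 < size gens) s /\ foldr (fun x g => gval gens x * g) 1 s = fgw w.
Proof.
split=> -[s [a e]]; exists s; split=> //; first by rewrite -fgw_flatten_gval; apply: val_inj.
by move/(congr1 val): e; rewrite -fgw_flatten_gval.
Qed.

Lemma in_sub_fgw gens w : in_sub gens w <-> Ksub gens (fgw w).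
Proof. by rewrite /Ksub !in_subE valK_fg. Qed.

Lemma Ksub_ind gens (P : fg B -> Prop) : P 1 ->
  (forall x g, x.1 < size gens -> Ksub gens g -> P g -> P (gval gens x * g)) ->
  forall g, Ksub gens g -> P g.
Proof.
move=> P1 PM g /in_subE[s []]; rewrite valK_fg => + e; rewrite -{}e.
elim: s => [//|x s IH] /= /andP[lx a]; apply: PM => //; last exact: IH.
by apply/in_subE; exists s; rewrite valK_fg.
Qed.

Lemma Ksub1 gens : Ksub gens 1.
Proof. by apply/in_subE; exists [::]; rewrite valK_fg. Qed.

Lemma Ksub_gval gens x g : x.1 < size gens -> Ksub gens g -> Ksub gens (gval gens x * g).
Proof.
move=> lx /in_subE[s [a e]]; apply/in_subE; exists (x :: s).
split; first by rewrite /= lx.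
by rewrite valK_fg -(valK_fg g) -e.
Qed.

Lemma Ksub_subgroup gens : subgroup (Ksub gens).
Proof.
have KM g h : Ksub gens g -> Ksub gens h -> Ksub gens (g * h).
  move=> Kg Kh; elim/Ksub_ind: Kg => [|x k lx _ IH]; first by rewrite mul1g.
  by rewrite -mulgA; apply: Ksub_gval.
split=> //; first exact: Ksub1.
move=> g Kg; elim/Ksub_ind: Kg => [|[i b] k lx _ IH]; first by rewrite invg1; apply: Ksub1.
rewrite invgM; apply: KM => //.
have := @Ksub_gval gens (i, ~~ b) 1 lx (Ksub1 _); rewrite mulg1.
by rewrite /gval; case: b {lx} => /=; rewrite ?invgK.
Qed.

(** The loops at the base vertex [v] read the group [g0 H g0^-1], so the vertex of the coset [H g]
    is reached from [v] by [g0 g]. *)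
Definition pos G (v : nat) g0 x g := rdg G v (g0 * g) x.

Section Core.
Variables (gens : seq (word B)) (G : lgraph B) (v : nat) (g0 : fg B).
Hypotheses (wf : wf_graph G) (fd : folded G) (cn : connected G).
Hypotheses (dg : forall z, z < nv G -> 1 < degree G z) (lv : v < nv G).
Hypothesis rep : forall w : fg B, rdg G v w v <-> Ksub gens (g0^-1 * w * g0).

Lemma posP x g (w : fg B) : pos G v g0 x g -> rdg G x w x <-> sconj (Ksub gens) g w.
Proof.
move=> px; have E : g0^-1 * (g0 * g * w * (g0 * g)^-1) * g0 = g * w * g^-1.
  by rewrite invgM !mulgA mulVg mul1g mulgVK.
rewrite /sconj -E -rep; split=> r.
  by apply: rdg_mul (rdgV px) => //; apply: rdg_mul r.
have := rdg_mul fd (rdgV px) (rdg_mul fd r px).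
by rewrite mulgVK mulKg.
Qed.

Lemma pos_eq x g x' g' : pos G v g0 x g -> pos G v g0 x' g' ->
  x = x' <-> Ksub gens (g * g'^-1).
Proof.
move=> p p'; have E : g0^-1 * (g0 * g * (g0 * g')^-1) * g0 = g * g'^-1.
  by rewrite invgM !mulgA mulVg mul1g mulgVK.
rewrite -E -rep; split=> [e|r]; first by subst x'; apply: rdg_mul (rdgV p').
by have := rdg_mul fd r p'; rewrite mulgVK => /(rdg_det fd p).
Qed.

Lemma pos_exists x : x < nv G -> exists g, pos G v g0 x g.
Proof.
move=> lx; have [p [_ e]] := cn lv lx.
exists (g0^-1 * fgw (walk_label p)); rewrite /pos mulVKg.
by apply: rdg_fgw => //; apply/rdP; exists p.
Qed.

Lemma pos_star x g l : pos G v g0 x g -> starb G x l <-> star (sconj (Ksub gens) g) l.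
Proof.
move=> px; have E : sconj (Ksub gens) g = fun k => rdg G x k x.
  by apply: funext => k; apply: propext; rewrite (posP _ px).
rewrite E; split; first exact: star_of_starb.
move=> /starP/(_ 0)[k [s [+ _ ek]]]; rewrite /rdg ek => -[y [st _]].
by apply/starbP; exists y.
Qed.

(** By [big_prefix] some loop at [v] runs along [g0 g] and beyond, so the reading of [g0 g] stays
    inside the core. *)
Lemma star_pos g l m : l != m -> star (sconj (Ksub gens) g) l ->
  star (sconj (Ksub gens) g) m -> exists2 x, x < nv G & pos G v g0 x g.
Proof.
move=> ne sl sm; pose u := g0 * g.
have E : sconj (Ksub gens) g = sconj (fun k => rdg G v k v) u.
  apply: funext => k; apply: propext; rewrite /sconj rep /u.
  by rewrite invgM !mulgA mulVg mul1g mulgVK.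
have bu : big (sconj (fun k => rdg G v k v) u) by rewrite -E; exists l, m.
have [q [k [s [rk ek]]]] := big_prefix bu.
move: rk; rewrite /rdg ek -cats1 -catA => /rd_cat[x [r1 [y [st _]]]].
by exists x => //; case: (step_wf wf st).
Qed.

End Core.

Definition verts (Gs : seq (lgraph B)) : seq (nat * nat) :=
  [seq (j, x) | j <- iota 0 (size Gs), x <- iota 0 (nv (nth (G0 B) Gs j))].

Lemma mem_verts Gs j x :
  ((j, x) \in verts Gs) = (j < size Gs) && (x < nv (nth (G0 B) Gs j)).
Proof.
apply/allpairsPdep/andP => [[j' [x' [i1 i2 [-> ->]]]]|[lj lx]].
  by move: i1 i2; rewrite !mem_iota !add0n.
by exists j, x; rewrite !mem_iota !add0n.
Qed.

Definition starv Gs (jx : nat * nat) l := starb (nth (G0 B) Gs jx.1) jx.2 l.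
Definition Kf (Hs : seq (seq (word B))) j := Ksub (nth [::] Hs j).

(* [ps (j, x) g] means that the vertex [x] of the [j]-th graph is the coset [H_j g]. *)
Record coset_model Hs Gs (ps : nat * nat -> fg B -> Prop) : Prop := CosetModel {
  cm_size : size Gs = size Hs;
  cm_ex : forall jx, jx \in verts Gs -> exists g, ps jx g;
  cm_eq : forall j x x' g g', ps (j, x) g -> ps (j, x') g' ->
    x = x' <-> Kf Hs j (g * g'^-1);
  cm_star : forall jx g l, ps jx g -> starv Gs jx l <-> star (sconj (Kf Hs jx.1) g) l;
  cm_pos : forall j g l m, j < size Hs -> l != m ->
    star (sconj (Kf Hs j) g) l -> star (sconj (Kf Hs j) g) m ->
    exists2 x, (j, x) \in verts Gs & ps (j, x) g;
  cm_two : forall jx, jx \in verts Gs ->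
    exists l m, [/\ l != m, starv Gs jx l & starv Gs jx m]
}.

Lemma coset_model_exists Hs Gs : sigma_seq Hs Gs -> exists ps, coset_model Hs Gs ps.
Proof.
case=> sz cor; pose Gj j := nth (G0 B) Gs j.
(* Base vertex and conjugator are fixed for all indices at once; [(0, 1)] is a filler for empty
   graphs and for indices out of range. *)
have /choice[f fP] : forall j, exists p : nat * fg B, j < size Hs -> nv (Gj j) = 0 \/
    (p.1 < nv (Gj j) /\
     forall w : fg B, rdg (Gj j) p.1 w p.1 <-> Kf Hs j (p.2^-1 * w * p.2)).
  move=> j.
  have [lj|] := ltnP j (size Hs); last by exists (0, 1).
  have [wf fd cn dg] := cor j lj; case=> [[n0 _]|[v [g [lv rp]]]]; first by exists (0, 1); left.
  exists (v, fgw g) => _; right; split=> // w /=.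
  have := rp (val w); rewrite reducedE red_val => /(_ isT) E.
  rewrite in_sub_fgw in E.
  have -> : (fgw g)^-1 * w * fgw g = fgw (reduce (winv g ++ val w ++ g)).
    apply: val_inj; rewrite val_fgw reduceK -val_fgw !fgw_cat fgw_winv valK_fg.
    by rewrite mulgA.
  rewrite /Kf -E; split=> [/rdP[p [e1 e2]]|[p [e1 e2]]].
    by exists p; rewrite e2 reduce_id // red_val.
  by rewrite /rdg -e2; apply: rd_reduce => //; apply/rdP; exists p.
exists (fun jx g => [/\ jx.1 < size Hs, jx.2 < nv (Gj jx.1) &
  pos (Gj jx.1) (f jx.1).1 (f jx.1).2 jx.2 g]).
have ctx j : j < size Hs -> 0 < nv (Gj j) -> (f j).1 < nv (Gj j) /\
     forall w : fg B, rdg (Gj j) (f j).1 w (f j).1 <-> Kf Hs j ((f j).2^-1 * w * (f j).2).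
  by move=> lj; case: (fP j lj) => [->|].
split=> //.
- move=> [j x]; rewrite mem_verts sz => /andP[lj lx].
  have [wf fd cn dg _] := cor j lj; have [lv rp] := ctx j lj (leq_ltn_trans (leq0n x) lx).
  have [g pg] := pos_exists (f j).2 fd cn lv lx.
  by exists g.
- move=> j x x' g g' [/= lj lx px] [_ _ px'].
  have [wf fd cn dg _] := cor j lj; have [lv rp] := ctx j lj (leq_ltn_trans (leq0n x) lx).
  exact: (pos_eq fd rp px px').
- move=> [j x] g l [/= lj lx px].
  have [wf fd cn dg _] := cor j lj; have [lv rp] := ctx j lj (leq_ltn_trans (leq0n x) lx).
  exact: (pos_star wf fd cn dg rp l px).
- move=> j g l m lj ne sl sm.
  have [wf fd cn dg rp0] := cor j lj.
  have [n0|nz] := posnP (nv (Gj j)); last first.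
    have [lv rp] := ctx j lj nz; have [x lx px] := star_pos wf rp ne sl sm.
    by exists x; rewrite ?mem_verts ?sz ?lj.
  (* An empty core belongs to the trivial group, which has no long elements and hence no
     directions. *)
  case: rp0 => [[_ tr]|[v [_ [+ _]]]]; last by rewrite -/(Gj j) n0.
  have /starP/(_ 1%N)[k [s [Kk lk ek]]] := sl.
  have k1 : g * k * g^-1 = 1 by apply: val_inj; have := tr _ Kk; rewrite reduce_id ?red_val.
  have k2 : k = 1 by apply: (mulgI g); apply: (mulIg g^-1); rewrite k1 mulg1 mulgV.
  by rewrite k2 len1 in lk.
- move=> [j x]; rewrite mem_verts sz => /andP[lj lx].
  have [wf fd cn dg _] := cor j lj.
  exact: degree_letters fd (dg x lx).
Qed.

End Reading.

(** * Existence of core graphs *)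

Section CoreExists.
Variable B : finType.
Local Open Scope group_scope.
Implicit Types (l m q : letter B) (g h k : fg B) (w : word B).

(** Cancelling a pair removes a detour from the path in the Cayley tree, so the reduced path only
    visits vertices of the original one. *)
Lemma prefix_reduce w i : exists j, fgw (take i (reduce w)) = fgw (take j w).
Proof.
elim: w i => [|l w IH] i; first by exists 0.
rewrite /= -/(reduce w).
have aux r : (forall i, exists j, fgw (take i r) = fgw (take j w)) ->
    exists j, fgw (take i (l :: r)) = fgw (take j (l :: w)).
  move=> H; case: i => [|i]; first by exists 0.
  by have [j ej] := H i; exists j.+1; rewrite /= !fgw_cons ej.
case er: (reduce w) => [|m r] /=; rewrite er in IH; first exact: aux.
case: eqP => [em|_]; last exact: aux.
have [j ej] := IH i.+1; exists j.+1; rewrite /= fgw_cons -ej /= fgw_cons em.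
by rewrite lt_linv mulVKg.
Qed.

Lemma letters_degree (G : lgraph B) x l m : l != m -> starb G x l -> starb G x m ->
  1 < degree G x.
Proof.
have two (a : pred (nat * B * nat)) e1 e2 : e1 != e2 -> e1 \in edges G ->
    e2 \in edges G -> a e1 -> a e2 -> 1 < count a (edges G).
  move=> ne i1 i2 a1 a2; rewrite -size_filter.
  apply: (@uniq_leq_size _ [:: e1; e2]); first by rewrite /= inE ne.
  by move=> e; rewrite !inE mem_filter => /orP[]/eqP->; apply/andP.
have one (a : pred (nat * B * nat)) e : e \in edges G -> a e -> 0 < count a (edges G).
  by move=> ie ae; rewrite -has_count; apply/hasP; exists e.
case: l m => [b s] [c t] ne /hasP[e1 i1 /= /andP[/eqP l1 x1]] /hasP[e2 i2 /= /andP[/eqP l2 x2]].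
rewrite /degree; case: s t x1 x2 ne => -[] /= x1 x2 ne.
- apply: leq_trans (leq_addl _ _); apply: two i1 i2 x1 x2.
  by apply: contraNneq ne => e; rewrite -l1 -l2 e.
- by have := one (fun e => etgt e == x) _ i1 x1; have := one (fun e => esrc e == x) _ i2 x2; lia.
- by have := one (fun e => etgt e == x) _ i2 x2; have := one (fun e => esrc e == x) _ i1 x1; lia.
- apply: leq_trans (leq_addr _ _); apply: two i1 i2 x1 x2.
  by apply: contraNneq ne => e; rewrite -l1 -l2 e.
Qed.

Variable gens : seq (word B).
Let K := Ksub gens.

Lemma K_mul g h : K g -> K h -> K (g * h).
Proof. by have [_ KM _] := Ksub_subgroup gens; apply: KM. Qed.
Lemma K_inv g : K g -> K g^-1.
Proof. by have [_ _] := Ksub_subgroup gens; apply. Qed.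

(** By [big_in_prefixes] every core vertex is the coset of such a prefix; finite generation enters
    here, to make the core finite. *)
Definition prefixes : seq (fg B) :=
  1 :: flatten [seq [seq fgw (take i w) | i <- iota 0 (size w).+1] | w <- gens].

Lemma mem_prefixes w i : w \in gens -> fgw (take i w) \in prefixes.
Proof.
move=> iw; rewrite inE; apply/orP; right; apply/flatten_mapP; exists w => //.
apply/mapP; exists (minn i (size w)); first by rewrite mem_iota add0n ltnS geq_minr.
have [le|lt] := leqP i (size w); first by [].
by rewrite take_size take_oversize // ltnW.
Qed.

Lemma gval_prefix x i : x.1 < size gens ->
  exists2 u, u \in prefixes & K (fgw (take i
    (if x.2 then winv (nth [::] gens x.1) else nth [::] gens x.1)) * u^-1).
Proof.
case: x => n b /= ln; set w := nth _ _ _; have iw : w \in gens by apply: mem_nth.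
case: b; last by exists (fgw (take i w)); rewrite ?mem_prefixes // mulgV; apply: Ksub1.
exists (fgw (take (size w - i) w)); first exact: mem_prefixes.
(* A prefix of [w^-1] is the inverse of a suffix of [w]; it is the complementary prefix of [w]
   multiplied on the left by [w^-1], an element of [K]. *)
have -> : fgw (take i (winv w)) = (fgw (drop (size w - i) w))^-1.
  by rewrite -fgw_winv /winv take_rev size_map map_drop.
rewrite -invgM -fgw_cat cat_take_drop; apply: K_inv.
have := @Ksub_gval _ gens (n, false) 1 ln (Ksub1 _).
by rewrite mulg1.
Qed.

Lemma raw_prefix (s : seq (nat * bool)) j : all (fun x => x.1 < size gens) s ->
  exists2 u, u \in prefixes & K (fgw (take j (flatten
   [seq if x.2 then winv (nth [::] gens x.1) else nth [::] gens x.1 | x <- s])) * u^-1).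
Proof.
elim: s j => [|x s IH] j /=; first by exists 1; rewrite ?inE ?eqxx // mulgV; apply: Ksub1.
move=> /andP[lx a]; rewrite take_cat; case: ltnP => [_|le]; first exact: gval_prefix.
have [u iu Ku] := IH (j - size (if x.2 then winv (nth [::] gens x.1) else nth [::] gens x.1)) a.
exists u => //; rewrite fgw_cat -mulgA; apply: K_mul => //.
have := @Ksub_gval _ gens x 1 lx (Ksub1 _).
by rewrite mulg1 /gval; case: (x.2) => //; rewrite fgw_winv.
Qed.

Lemma element_prefix k i : K k ->
  exists2 u, u \in prefixes & K (fgw (take i (val k)) * u^-1).
Proof.
case=> s [a]; rewrite (reduce_id (red_val k)) => e; rewrite -e.
by have [j ->] := prefix_reduce (flatten [seq if x.2 then winv (nth [::] gens x.1)
   else nth [::] gens x.1 | x <- s]) i; exact: raw_prefix.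
Qed.

Lemma big_in_prefixes g : big (sconj K g) -> exists2 u, u \in prefixes & K (g * u^-1).
Proof.
move=> /big_prefix[q [k [s [Kk ek]]]].
have [u iu Ku] := element_prefix (size (val g)) Kk; exists u => //.
by move: Ku; rewrite ek -cats1 -catA take_size_cat // valK_fg.
Qed.

(** A pass through [prefixes] keeps an element when its coset is [big] and not yet represented. *)
Lemma coset_reps : exists L : seq (fg B),
  [/\ forall i, i < size L -> big (sconj K (nth 1 L i)),
      forall i j, i < size L -> j < size L -> K (nth 1 L i * (nth 1 L j)^-1) -> i = j &
      forall g, big (sconj K g) -> exists2 i, i < size L & K (g * (nth 1 L i)^-1)].
Proof.
suff H (W : seq (fg B)) : exists L : seq (fg B),
  [/\ forall u, u \in L -> big (sconj K u),
      pairwise (fun u v => ~~ `[< K (u * v^-1) >]) L &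
      forall g, g \in W -> big (sconj K g) -> exists2 u, u \in L & K (g * u^-1)].
  have [L [Lb Lp Lc]] := H prefixes; exists L; split.
  - by move=> i li; apply: Lb; apply: mem_nth.
  - move=> i j li lj Kij; move/(pairwiseP 1): Lp => Lp.
    case: (ltngtP i j) => // lij.
      by have := Lp i j li lj lij; rewrite asboolT.
    have := Lp j i lj li lij; rewrite asboolT //.
    by move/K_inv: Kij; rewrite invgM invgK.
  move=> g bg; have [u iu Ku] := big_in_prefixes bg.
  have bu : big (sconj K u).
    move: bg; rewrite -(mulgVK u g) sconj_mem //; exact: Ksub_subgroup.
  have [u' iu' Ku'] := Lc u iu bu; exists (index u' L); first by rewrite index_mem.
  by rewrite nth_index //; have := K_mul Ku Ku'; rewrite mulgA mulgVK.
elim: W => [|u W [L [Lb Lp Lc]]]; first by exists [::].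
have [[bu nu]|no] := pselect (big (sconj K u) /\ forall v, v \in L -> ~ K (u * v^-1)).
  exists (u :: L); split.
  - by move=> v; rewrite inE => /orP[/eqP->|/Lb].
  - rewrite pairwise_cons Lp andbT; apply/allP => v iv; rewrite asboolF //; exact: nu.
  move=> g; rewrite inE => /orP[/eqP->|ig] bg.
    by exists u; rewrite ?mem_head // mulgV; apply: Ksub1.
  by have [v iv Kv] := Lc g ig bg; exists v; rewrite ?inE ?iv ?orbT.
exists L; split=> // g; rewrite inE => /orP[/eqP->|ig] bg; last exact: Lc.
apply: contrapT => nx; apply: no; split=> // v iv Kv; apply: nx.
by exists v.
Qed.

Section Graph.
Variable L : seq (fg B).
Hypothesis Lb : forall i, i < size L -> big (sconj K (nth 1 L i)).
Hypothesis Lu : forall i j, i < size L -> j < size L ->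
  K (nth 1 L i * (nth 1 L j)^-1) -> i = j.
Hypothesis Lc : forall g, big (sconj K g) ->
  exists2 i, i < size L & K (g * (nth 1 L i)^-1).

(** This is the Schreier coset graph of [K] restricted to the [big] cosets. *)
Definition coset_graph : lgraph B := LGraph (size L)
  [seq (nat_of_ord t.1.1, t.1.2, nat_of_ord t.2) |
     t : 'I_(size L) * B * 'I_(size L) <- enum {: 'I_(size L) * B * 'I_(size L)} &
     `[< K (nth 1 L t.1.1 * lt (t.1.2, false) * (nth 1 L t.2)^-1) >]].

Lemma coset_edge i b j : (i, b, j) \in edges coset_graph <->
  [/\ i < size L, j < size L & K (nth 1 L i * lt (b, false) * (nth 1 L j)^-1)].
Proof.
split.
  case/mapP => -[[i' b'] j']; rewrite mem_filter => /andP[/asboolP /= Kt _] [-> -> ->].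
  by split.
case=> li lj Kij; apply/mapP; exists (Ordinal li, b, Ordinal lj) => //.
by rewrite mem_filter mem_enum inE andbT; apply/asboolP.
Qed.

Lemma coset_step i l j : step coset_graph i l j <->
  [/\ i < size L, j < size L & K (nth 1 L i * lt l * (nth 1 L j)^-1)].
Proof.
rewrite /step; case: l => b [] /=; last exact: coset_edge.
rewrite coset_edge.
have E : nth 1 L i * lt (b, true) * (nth 1 L j)^-1 =
    (nth 1 L j * lt (b, false) * (nth 1 L i)^-1)^-1.
  by rewrite !invgM invgK -lt_linv mulgA.
by rewrite E; split=> -[li lj /K_inv]; rewrite ?invgK; split.
Qed.

Lemma coset_rd_sub i w j : i < size L -> rd coset_graph i w j ->
  j < size L /\ K (nth 1 L i * fgw w * (nth 1 L j)^-1).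
Proof.
elim: w i => [|l w IH] i li /=.
  by move=> <-; rewrite fgw_nil mulg1 mulgV; split=> //; apply: Ksub1.
case=> z [/coset_step[_ lz Kz] /(IH _ lz)[lj Kj]]; split=> //.
by have := K_mul Kz Kj; rewrite fgw_cons !mulgA mulgVK.
Qed.

Lemma coset_rd_big i w j : i < size L -> j < size L ->
  (forall t, big (sconj K (nth 1 L i * fgw (take t w)))) ->
  K (nth 1 L i * fgw w * (nth 1 L j)^-1) -> rd coset_graph i w j.
Proof.
elim: w i => [|l w IH] i li lj bg /=.
  by rewrite fgw_nil mulg1 => /Lu->.
have := bg 1%N; rewrite /= take0 -/(lt l) => /Lc[z lz Kz].
rewrite fgw_cons mulgA => Kj; exists z; split; first by apply/coset_step.
apply: IH => // [t|]; last first.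
  by have := K_mul (K_inv Kz) Kj; rewrite invgF -(mulgA (_ * _)) divgKA mulgA.
have := bg t.+1; rewrite /= fgw_cons mulgA.
rewrite -(sconj_mem (nth 1 L z * fgw (take t w)) (Ksub_subgroup gens) Kz).
by rewrite !mulgA mulgVK.
Qed.

(** By [big_convex], applied to the conjugate of [K] at vertex [i], a reduced path between two [big]
    cosets passes through [big] cosets only. *)
Lemma coset_rd i w j : i < size L -> j < size L -> red w ->
  K (nth 1 L i * fgw w * (nth 1 L j)^-1) -> rd coset_graph i w j.
Proof.
move=> li lj rw Kw; apply: coset_rd_big => // t.
rewrite -sconjM; apply: (@big_convex _ _ _ (drop t w)); rewrite ?cat_take_drop //.
  exact: Lb.
rewrite sconjM -(mulgVK (nth 1 L j) (_ * _)) sconj_mem //; last exact: Ksub_subgroup.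
exact: Lb.
Qed.

Lemma coset_graph_core : core_of gens coset_graph.
Proof.
split.
- apply/allP => -[[i b] j]; rewrite coset_edge => -[li lj _].
  by rewrite /esrc /etgt /= li lj.
- split.
    rewrite map_inj_in_uniq; first by apply: filter_uniq; apply: enum_uniq.
    by move=> [[i b] j] [[i' b'] j'] _ _ /= [/val_inj-> -> /val_inj->].
  move=> [[i b] j] [[i' b'] j']; rewrite !coset_edge => -[li lj Kij] [li' lj' Kij'] ne.
  rewrite /elab /esrc /etgt /=; have [eb|nb] := eqVneq b b'; last by left.
  subst b'; right; split; apply: contraNneq ne => e; subst.
    suff -> : j = j' by [].
    apply: Lu => //; have := K_mul (K_inv Kij) Kij'.
    by rewrite !invgM invgK !mulgA mulgVK mulgK.
  suff -> : i = i' by [].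
  apply: Lu => //; have := K_mul Kij (K_inv Kij').
  by rewrite !invgM invgK !mulgA mulgVK mulgK.
- move=> i j li lj.
  have /rdP[p [e _]] : rd coset_graph i (val ((nth 1 L i)^-1 * nth 1 L j)) j.
    by apply: coset_rd; rewrite ?red_val // valK_fg mulVKg mulgV; apply: Ksub1.
  by exists p; split=> //; apply/allP.
- move=> i li; have [l [m [ne sl sm]]] := Lb li.
  have sb q : star (sconj K (nth 1 L i)) q -> starb coset_graph i q.
    move=> /starP/(_ 0)[k [s [Kk _ ek]]]; apply/starbP.
    have : rd coset_graph i (val k) i by apply: coset_rd; rewrite ?red_val ?valK_fg.
    by rewrite ek => -[z [st _]]; exists z.
  by apply: letters_degree ne _ _; apply: sb.
(* If no coset is [big], then [exists_big] leaves only the trivial group. *)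
have [n0|nz] := posnP (size L).
  left; split=> // w /in_sub_fgw Kw; apply/eqP; apply: contraT => nw.
  have [||g /Lc[i]] := @exists_big _ K (fgw w) (Ksub_subgroup gens); last by rewrite n0.
    exact: Kw.
  by apply: contra nw => /eqP/(congr1 val)/= ->.
(* The base vertex is the coset of [nth 1 L 0], and the inverse of that element is the
   conjugator. *)
right; exists 0, (winv (val (nth 1 L 0))); split=> // w; rewrite reducedE => rw.
have -> : in_sub gens (reduce (winv (winv (val (nth 1 L 0))) ++ w ++ winv (val (nth 1 L 0))))
    <-> K (nth 1 L 0 * fgw w * (nth 1 L 0)^-1).
  rewrite in_sub_fgw winvK; suff -> : fgw (reduce (val (nth 1 L 0) ++ w ++ winv (val (nth 1 L 0))))
    = nth 1 L 0 * fgw w * (nth 1 L 0)^-1 by [].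
  apply: val_inj; rewrite val_fgw reduceK -val_fgw !fgw_cat fgw_winv valK_fg.
  by rewrite mulgA.
split=> [[p [e1 e2]]|Kw].
  have r : rd coset_graph 0 (walk_label p) 0 by apply/rdP; exists p.
  have [_] := coset_rd_sub nz r.
  suff -> : fgw (walk_label p) = fgw w by [].
  by apply: val_inj; rewrite !val_fgw e2 reduce_id.
have /rdP[p [e1 e2]] := coset_rd nz nz rw Kw.
by exists p; rewrite e2 reduce_id.
Qed.

End Graph.

Lemma core_exists : exists G, core_of gens G.
Proof. by have [L [Lb Lu Lc]] := coset_reps; exists (coset_graph L); apply: coset_graph_core. Qed.

End CoreExists.

Lemma sigma_exists (B : finType) (Hs : seq (seq (word B))) : exists Gs, sigma_seq Hs Gs.
Proof.
have /choice[f fP] := @core_exists B; exists (map f Hs); split; first by rewrite size_map.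
by move=> i li; rewrite (nth_map [::]).
Qed.

(** * Whitehead automorphisms *)

Section Ext.
Variable B : finType.
Local Open Scope group_scope.
Implicit Types (l m q : letter B) (g h k : fg B) (w : word B) (a : B -> word B).
Implicit Types (Hs : seq (seq (word B))) (Gs : seq (lgraph B)) (Q D : pred (letter B)).

Definition ev a w : fg B := fgw (flatten [seq if l.2 then winv (a l.1) else a l.1 | l <- w]).

Lemma ev_cat a u v : ev a (u ++ v) = ev a u * ev a v.
Proof. by rewrite /ev map_cat flatten_cat fgw_cat. Qed.

Lemma ev_linv a l : ev a [:: linv l] = (ev a [:: l])^-1.
Proof. by rewrite /ev /= !cats0 -fgw_winv; case: l => b [] /=; rewrite ?winvK. Qed.

Lemma ev_reduce a w : ev a (reduce w) = ev a w.
Proof.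
elim: w => [//|l w IH] /=; rewrite -/(reduce w) -(cat1s l w) ev_cat -IH.
case: (reduce w) => [|m v] /=; first by rewrite -(ev_cat a [:: l] [::]).
case: eqP => [->|_]; last by rewrite -ev_cat.
by rewrite -(cat1s (linv l) v) ev_cat ev_linv mulVKg.
Qed.

Definition Ext a g : fg B := ev a (val g).

Lemma Ext_fgw a w : Ext a (fgw w) = ev a w.
Proof. exact: ev_reduce. Qed.

Lemma extE a w : ext a w = val (Ext a (fgw w)).
Proof. by rewrite Ext_fgw. Qed.

Lemma fgw_ext a w : fgw (ext a w) = Ext a (fgw w).
Proof. by rewrite extE valK_fg. Qed.

Lemma ExtM a : {morph Ext a : g h / g * h}.
Proof. by move=> g h; rewrite /Ext val_mul ev_reduce ev_cat. Qed.

Lemma Ext_lt a l : Ext a (lt l) = if l.2 then (fgw (a l.1))^-1 else fgw (a l.1).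
Proof. by rewrite Ext_fgw /ev /= cats0; case: (l.2); rewrite ?fgw_winv. Qed.

Lemma Ext_comp a a2 g : Ext (fun c => ext a (a2 c)) g = Ext a (Ext a2 g).
Proof.
elim/fg_ind: g => [|g l IH]; first by rewrite !(morph1 (@ExtM _)).
rewrite !ExtM IH !Ext_lt fgw_ext; congr (_ * _).
by case: (l.2); rewrite ?(morphV (@ExtM _)).
Qed.

Lemma is_autE a : is_aut a <-> exists a', auto (Ext a) (Ext a').
Proof.
split=> -[a' H]; exists a'.
  have H' g : Ext a' (Ext a g) = g /\ Ext a (Ext a' g) = g.
    have rg : reduced (val g) by rewrite reducedE red_val.
    have [e1 e2] := H _ rg; rewrite !extE !valK_fg in e1 e2.
    by split; apply: val_inj.
  by split=> [||g|g]; rewrite ?(H' _).1 ?(H' _).2 //; apply: ExtM.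
case: H => _ _ c1 c2 w; rewrite reducedE => rw.
by rewrite !extE !valK_fg c1 c2 val_fgw_red.
Qed.

Lemma Ksub_map_ext a f' gens g : auto (Ext a) f' ->
  Ksub (map (ext a) gens) g <-> Ksub gens (f' g).
Proof.
case=> fM f'M fK f'K.
have gE x : x.1 < size gens -> gval (map (ext a) gens) x = Ext a (gval gens x).
  move=> lx; rewrite /gval (nth_map [::]) // fgw_ext.
  by case: (x.2) => //; rewrite (morphV fM).
split=> H.
  elim/Ksub_ind: H => [|x k lx _ IH]; first by rewrite (morph1 f'M); apply: Ksub1.
  rewrite size_map in lx; rewrite f'M gE // fK; exact: Ksub_gval.
rewrite -(f'K g); move: H; move: (f' g) => k.
elim/Ksub_ind => [|x h lx _ IH]; first by rewrite (morph1 fM); apply: Ksub1.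
by rewrite fM -gE //; apply: Ksub_gval; rewrite ?size_map.
Qed.

Lemma Kf_aut_act a f' Hs j g : auto (Ext a) f' ->
  Kf (aut_act a Hs) j g <-> Kf Hs j (f' g).
Proof.
move=> af; rewrite /Kf /aut_act; have [lj|gj] := ltnP j (size Hs).
  by rewrite (nth_map [::]) //; apply: Ksub_map_ext.
(* Out of range both sides concern the trivial group, generated by the empty list. *)
rewrite !nth_default ?size_map // -(Ksub_map_ext [::] g af) //.
Qed.

(** * Counting the cosets that cross a partition *)

Definition crossv Gs Q (jx : nat * nat) :=
  [exists l : letter B, Q l && starv Gs jx l] && [exists l : letter B, ~~ Q l && starv Gs jx l].
Definition cap Q Gs := count (crossv Gs Q) (verts Gs).

Lemma crossvP Gs Q jx : reflect (exists l m, [/\ Q l, ~~ Q m, starv Gs jx l & starv Gs jx m])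
  (crossv Gs Q jx).
Proof.
apply: (iffP andP) => [[/existsP[l /andP[]] ? ? /existsP[m /andP[]] ? ?]|].
  by exists l, m.
by case=> l [m [? ? ? ?]]; split; apply/existsP; [exists l|exists m]; apply/andP.
Qed.

Lemma uniq_verts Gs : uniq (verts Gs).
Proof.
apply: allpairs_uniq_dep => [|j _|]; rewrite ?iota_uniq //.
by move=> [j x] [j' x'] _ _ /= [-> ->].
Qed.

Lemma leq_size_rel (T U : eqType) (s : seq T) (t : seq U) (R : T -> U -> Prop) :
  uniq s -> (forall x, x \in s -> exists2 y, y \in t & R x y) ->
  (forall x x' y, x \in s -> x' \in s -> R x y -> R x' y -> x = x') ->
  size s <= size t.
Proof.
elim: s t => [//|x s IH] t /= /andP[xs us] ex inj.
have [y yt Rxy] := ex x (mem_head _ _).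
have ts := size_rem yt; have t0 : 0 < size t by case: (t) yt.
suff : size s <= size (rem y t) by rewrite ts; lia.
apply: IH => // [x' x's|x1 x2 y' i1 i2]; last by apply: inj; rewrite inE ?i1 ?i2 orbT.
have [y' y't Rxy'] := ex x' (mem_behead (s := x :: s) x's); exists y' => //.
have [e|ne] := eqVneq y' y.
  subst y'; move: xs; rewrite (inj x x' y) ?mem_head ?x's //.
  by rewrite inE x's orbT.
by have := perm_to_rem yt => /perm_mem/(_ y'); rewrite y't inE (negbTE ne).
Qed.

(** Each edge carrying the letter is sent to the vertex from which the letter is read; foldedness
    makes this map injective. *)
Lemma count_lab_star (G : lgraph B) l : wf_graph G -> folded G ->
  count (fun e => elab e == l.1) (edges G) = count (fun x => starb G x l) (iota 0 (nv G)).
Proof.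
move=> /allP wf [ue fd]; rewrite -!size_filter.
set en := fun e : nat * B * nat => if l.2 then etgt e else esrc e.
rewrite -(size_map en); apply: perm_size; apply: uniq_perm.
- rewrite map_inj_in_uniq ?filter_uniq // => e1 e2.
  rewrite !mem_filter => /andP[/eqP l1 i1] /andP[/eqP l2 i2] ee.
  apply/eqP; apply: contraT => /(fd _ _ i1 i2).
  rewrite l1 l2 eqxx => -[//|[]]; move: ee; rewrite /en.
  by case: ifP => _ ->; rewrite eqxx.
- by rewrite filter_uniq // iota_uniq.
move=> x; rewrite mem_filter mem_iota add0n /=; apply/mapP/andP => [[e]|[/hasP[e ie]]].
  rewrite mem_filter => /andP[le ie] ->; split.
    by apply/hasP; exists e; rewrite ?le //= eqxx.
  by have /andP[] := wf e ie; rewrite /en; case: ifP.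
by move=> /andP[le /eqP ex] _; exists e; rewrite ?mem_filter ?le //.
Qed.

Lemma nlab_star Hs Gs l : sigma_seq Hs Gs ->
  nlab l.1 Gs = count (fun jx => starv Gs jx l) (verts Gs).
Proof.
case=> sz cor; rewrite /nlab /verts count_flatten -map_comp; congr sumn.
rewrite -[in LHS](mkseq_nth (G0 B) Gs) /mkseq -map_comp.
apply/eq_in_map => j; rewrite mem_iota add0n => /= lj.
rewrite sz in lj; have [wf fd _ _ _] := cor j lj.
by rewrite count_lab_star // count_map.
Qed.

(** Every core vertex has two directions, so a vertex where [l] is readable always has an edge on
    the other side of [pred1 l] as well. *)
Lemma nlab_cap Hs Gs l : sigma_seq Hs Gs -> nlab l.1 Gs = cap (pred1 l) Gs.
Proof.
move=> sg; rewrite (nlab_star l sg); apply: eq_in_count => jx ijx.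
have [ps cm] := coset_model_exists sg.
have [m [m' [ne sm sm']]] := cm_two cm ijx.
apply/idP/crossvP => [sl|[l' [? [/eqP-> //]]]].
have [e|nl] := eqVneq m l; last by exists l, m; rewrite /= eqxx.
by exists l, m'; rewrite /= eqxx -e eq_sym.
Qed.

Lemma total_edgesE Gs : total_edges Gs = (\sum_b nlab b Gs)%N.
Proof.
rewrite /total_edges /nlab; under eq_bigr do rewrite sumnE big_map.
rewrite sumnE big_map exchange_big; apply: eq_bigr => G _.
elim: (edges G) => [|e s IH] /=; first by rewrite big1.
rewrite big_split /= -IH (bigD1 (elab e)) //= eqxx big1 ?addn0 // => b.
by rewrite eq_sym => /negbTE->.
Qed.

Section Crossing.
Variables (Hs1 : seq (seq (word B))) (Gs1 : seq (lgraph B)) (ps1 : nat * nat -> fg B -> Prop).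
Hypothesis cm1 : coset_model Hs1 Gs1 ps1.

Lemma crosses_crossv j g Q : j < size Hs1 -> crosses (sconj (Kf Hs1 j) g) (cone Q) ->
  exists x, [/\ (j, x) \in verts Gs1, ps1 (j, x) g & crossv Gs1 Q (j, x)].
Proof.
move=> lj /crosses_big[l [m [Ql Qm sl sm]]].
have ne : l != m by apply: contraNneq Qm => <-.
have [x ix px] := cm_pos cm1 lj ne sl sm; exists x; split=> //.
by apply/crossvP; exists l, m; split=> //; apply/(cm_star cm1 _ px).
Qed.

Lemma crossv_crosses jx g Q : ps1 jx g -> crossv Gs1 Q jx ->
  crosses (sconj (Kf Hs1 jx.1) g) (cone Q).
Proof.
move=> px /crossvP[l [m [Ql Qm /(cm_star cm1 _ px) sl /(cm_star cm1 _ px) sm]]].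
split; first exact: star_cone sl.
move: (@star_cone _ _ (predC Q) m Qm sm); apply: (@meets_mono _ 0) => h _.
by rewrite /cone; case: (val h).
Qed.

End Crossing.

(** [f] carries the first groups to the second, and the cone on [Q2] translated by [t] pulls back to
    the cone on [Q1]. Hence a coset of [g] crossing the second partition gives the coset of
    [f' (g t^-1)] crossing the first, injectively. *)
Lemma cap_le Hs1 Hs2 Gs1 Gs2 ps1 ps2 f f' Q1 Q2 (t : fg B) :
  coset_model Hs1 Gs1 ps1 -> coset_model Hs2 Gs2 ps2 -> auto f f' ->
  size Hs2 = size Hs1 -> (forall j g, Kf Hs2 j g <-> Kf Hs1 j (f' g)) ->
  (forall w : fg B, cone Q2 (t^-1 * f w) = cone Q1 w) ->
  cap Q2 Gs2 <= cap Q1 Gs1.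
Proof.
move=> cm1 cm2 af sz KK cE; have [fM f'M fK f'K] := af.
rewrite /cap -!size_filter.
pose R (jx2 jx1 : nat * nat) := jx2.1 = jx1.1 /\
  exists2 g, ps2 jx2 g & ps1 jx1 (f' (g * t^-1)).
apply: (@leq_size_rel _ _ _ _ R); first by rewrite filter_uniq // uniq_verts.
  move=> [j x]; rewrite mem_filter => /andP[cr ij].
  have lj : j < size Hs1 by move: ij; rewrite mem_verts (cm_size cm2) sz => /andP[].
  have [g pg] := cm_ex cm2 ij.
  have := crossv_crosses cm2 pg cr.
  rewrite -(crosses_sconj _ t^-1 (tame_cone Q2)) sconjM /=.
  have -> : Kf Hs2 j = fun k => Kf Hs1 j (f' k) by apply: funext => k; apply: propext.
  rewrite (crosses_auto _ _ _ af).
  have -> : (fun z => cone Q2 (t^-1 * f z)) = cone Q1 by apply: funext.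
  move=> /(crosses_crossv cm1 lj)[x1 [i1 p1 c1]].
  exists (j, x1); first by rewrite mem_filter c1.
  by split=> //; exists g.
move=> [j x] [j' x'] [j1 x1] _ _ [/= -> [g pg p1]] [/= ej [g' pg' p1']].
subst j'; congr (_, _); apply/(cm_eq cm2 pg pg'); rewrite KK.
have /(cm_eq cm1 p1 p1') := erefl x1.
by rewrite -(morphV f'M) -f'M invgM invgK mulgA mulgVK.
Qed.

End Ext.

(** * The Whitehead automorphism of a partition *)

Section Whitehead.
Variable B : finType.
Local Open Scope group_scope.
Variables (D : pred (letter B)) (b : B).
Hypotheses (Db : D (b, false)) (Dnb : ~~ D (b, true)).
Implicit Types (l : letter B) (g : fg B).

Let a : fg B := lt (b, false).

(** The Whitehead automorphism with multiplier [b] and set [D]; [s = true] replaces the multiplier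
    by its inverse, which gives the inverse automorphism. *)
Definition whf (s : bool) (c : B) : word B :=
  if c == b then [:: (b, false)] else
  (if D (c, false) then [:: (b, s)] else [::]) ++ (c, false) ::
  (if D (c, true) then [:: (b, ~~ s)] else [::]).

Lemma whf_lt s l : Ext (whf s) (lt l) =
  if l.1 == b then lt l else
  (if D l then lt (b, s) else 1) * lt l * (if D (linv l) then lt (b, ~~ s) else 1).
Proof.
rewrite Ext_fgw /ev /= cats0 /whf; case: l => c t /=; case: eqP => [->|_].
  by case: t.
have e (d : bool) l' : fgw (if d then [:: l'] else [::]) = if d then lt l' else 1 by case: d.
case: t => /=; rewrite ?fgw_winv fgw_cat fgw_cons !e //; last by rewrite mulgA.
rewrite !invgM -!lt_linv /linv /= .
by do 2!case: ifP => _; rewrite ?invg1 -?lt_linv /linv /= ?negbK.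
Qed.

Lemma whf_cancel s : cancel (Ext (whf s)) (Ext (whf (~~ s))).
Proof.
move=> g; elim/fg_ind: g => [|g l IH]; first by rewrite !(morph1 (@ExtM _ _)).
rewrite !ExtM IH; congr (_ * _); rewrite whf_lt.
have [e|ne] := eqVneq l.1 b; first by rewrite whf_lt e eqxx.
have cb t : Ext (whf (~~ s)) (lt (b, t)) = lt (b, t) by rewrite whf_lt eqxx.
have lv t : lt (b, ~~ t) = (lt (b, t))^-1 by rewrite -lt_linv.
rewrite !ExtM whf_lt (negbTE ne) negbK.
do 2!case: ifP => _; rewrite ?cb ?(morph1 (@ExtM _ _)) ?mulg1 ?mul1g //.
- by rewrite lv !mulgA mulgV mul1g mulgK.
- by rewrite lv !mulgA mulgV mul1g.
- by rewrite lv mulgK.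
Qed.

Lemma whf_auto : auto (Ext (whf false)) (Ext (whf true)).
Proof. by split; [exact: ExtM|exact: ExtM|exact: whf_cancel|exact: (@whf_cancel true)]. Qed.

Let phi := Ext (whf false).

Lemma whf_eq1 g : (phi g == 1) = (g == 1).
Proof.
have [fM _ fK _] := whf_auto.
by rewrite -{1}(morph1 fM) (inj_eq (can_inj fK)).
Qed.

(** Since [D] contains [b] and not [b^-1], the formula with an empty middle factor also covers the
    two letters of the multiplier. *)
Lemma phi_lt l : phi (lt l) =
  (if D l then a else 1) * (if l.1 == b then 1 else lt l) * (if D (linv l) then a^-1 else 1).
Proof.
have av : lt (b, true) = a^-1 by rewrite /a -lt_linv.
rewrite /phi whf_lt /= av; case: eqP => // e.
by case: l e => c [] /= ->; rewrite /linv /= Db (negbTE Dnb) ?mulg1 ?mul1g ?av.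
Qed.

Lemma cone_pred1 l g m : m.1 != l.1 -> cone (pred1 l) (g * lt m) = cone (pred1 l) g.
Proof.
move=> ne; rewrite cone_rec /=.
have -> : (m == l) = false by apply: contraNF ne => /eqP->.
have -> : (linv m == l) = false by apply: contraNF ne => /eqP<-.
by rewrite !andbF !addbF.
Qed.

Lemma cone_a g : cone (pred1 (b, false)) (g * a) = cone (pred1 (b, false)) g (+) (g == 1).
Proof. by rewrite cone_rec /= eqxx andbT /linv /= xpair_eqE andbF andbF addbF. Qed.

Lemma cone_aV g : cone (pred1 (b, false)) (g * a^-1) =
  cone (pred1 (b, false)) g (+) (g * a^-1 == 1).
Proof.
by rewrite -lt_linv cone_rec /= /linv /= eqxx xpair_eqE !andbF !andbT addbF.
Qed.

(** The path from [phi g] to [phi (g l)] has a [b]-edge only at its start, when [l] is in [D], and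
    at its end, when [l^-1] is. So the colour changes exactly where that of [cone D] does, and
    [cone_unique] applies. *)
Lemma cone_phi_a : (fun w => cone (pred1 (b, false)) (phi w)) =1 cone D.
Proof.
have fM : {morph phi : g h / g * h} := @ExtM _ _.
apply: cone_unique => [|g l]; first by rewrite (morph1 fM).
rewrite -(whf_eq1 g) -(whf_eq1 (g * lt l)) -/phi fM.
have e1 : cone (pred1 (b, false)) (phi g * (if D l then a else 1)) =
    cone (pred1 (b, false)) (phi g) (+) ((phi g == 1) && D l).
  by case: ifP => _; rewrite ?cone_a ?mulg1 ?andbT ?andbF ?addbF.
rewrite {1}phi_lt !mulgA; set h := _ * (if l.1 == b then _ else _).
have e2 : cone (pred1 (b, false)) h = cone (pred1 (b, false)) (phi g * (if D l then a else 1)).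
  by rewrite /h; case: eqP => [_|/eqP ne]; rewrite ?mulg1 // cone_pred1.
have e3 : phi g * phi (lt l) = h * (if D (linv l) then a^-1 else 1).
  by rewrite phi_lt !mulgA.
rewrite e3 -e1 -e2; case: ifP => _; first by rewrite cone_aV andbT.
by rewrite mulg1 andbF addbF.
Qed.

(** The only [c]-edge in the image of the letter [c] comes after the initial factor [t]; translation
    by [t^-1] brings it back to the identity. *)
Lemma cone_phi_c (c : B) : c != b ->
  (fun w => cone (pred1 (c, false)) ((if D (c, false) then a else 1)^-1 * phi w))
  =1 cone (pred1 (c, false)).
Proof.
move=> cb; have fM : {morph phi : g h / g * h} := @ExtM _ _.
set t := if _ then _ else _.
have ca (d : bool) h : cone (pred1 (c, false)) (h * (if d then a else 1)) = cone (pred1 (c, false)) h.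
  by case: d; rewrite ?mulg1 // cone_pred1 //= eq_sym.
have cV (d : bool) h : cone (pred1 (c, false)) (h * (if d then a^-1 else 1)) = cone (pred1 (c, false)) h.
  by case: d; rewrite ?mulg1 // -lt_linv cone_pred1 //= eq_sym.
apply: cone_unique => [|g l].
  rewrite (morph1 fM) mulg1 /t; case: ifP => _; last by rewrite invg1.
  by rewrite -lt_linv /cone /= xpair_eqE andbF.
rewrite -(whf_eq1 g) -(whf_eq1 (g * lt l)) -/phi fM.
rewrite {1}phi_lt !mulgA cV; have [e|ne] := eqVneq l.1 b.
  rewrite mulg1 ca /=.
  have -> : (l == (c, false)) = false by apply: contraNF cb => /eqP el; rewrite -e el.
  have -> : (linv l == (c, false)) = false by apply: contraNF cb => /eqP el; rewrite -e -[l.1]/((linv l).1) el.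
  by rewrite !andbF !addbF.
rewrite cone_rec ca /=; congr (_ (+) _ (+) _).
  have [el|_] := eqVneq l (c, false); last by rewrite !andbF.
  rewrite !andbT el -/t; rewrite -(inj_eq (mulgI t)) -(inj_eq (mulIg t^-1)).
  by rewrite !mulgA mulgV mul1g mulgK mulg1 mulgV.
have [el|_] := eqVneq (linv l) (c, false); last by rewrite !andbF.
rewrite !andbT; rewrite [phi (lt l)]phi_lt (negbTE ne) el.
have -> : (if D (c, false) then a^-1 else 1) = t^-1 by rewrite /t; case: ifP; rewrite ?invg1.
rewrite -(inj_eq (mulgI t)) -(inj_eq (mulIg t^-1)).
by rewrite !mulgA mulgV mul1g mulg1 mulgV.
Qed.

End Whitehead.

(** * The Whitehead inequality at a Gersten representative *)

Section Minimal.
Variable B : finType.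
Local Open Scope group_scope.

(** After the Whitehead automorphism the count of [b] is at most [cap D] by [cone_phi_a], and no
    other count increases by [cone_phi_c]; minimality of the total does the rest. *)
Lemma whitehead_ineq_pos beta (Hs : seq (seq (word B))) Gs (D : pred (letter B)) b :
  gersten beta Hs -> sigma_seq (aut_act beta Hs) Gs -> D (b, false) -> ~~ D (b, true) ->
  nlab b Gs <= cap D Gs.
Proof.
move=> [aut_b minb] sg Db Dnb.
pose beta' c := ext (whf D b false) (beta c).
have wa := whf_auto D b.
have E g : Ext beta' g = Ext (whf D b false) (Ext beta g) by apply: Ext_comp.
have [betaV ab] := (is_autE _).1 aut_b.
have a2 : auto (Ext beta') (fun g => Ext betaV (Ext (whf D b true) g)).
  have [fM gM fK gK] := wa; have [hM kM hK kK] := ab.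
  split=> [||g|g]; first exact: ExtM.
  - by move=> g h; rewrite gM kM.
  - by rewrite E fK hK.
  - by rewrite E kK gK.
have autb' : is_aut beta'.
  apply/is_autE; exists (fun c => ext betaV (whf D b true c)).
  suff -> : Ext (fun c => ext betaV (whf D b true c)) =
            fun g => Ext betaV (Ext (whf D b true) g) by [].
  by apply: funext => g; apply: Ext_comp.
(* [cplx_le] quantifies over all core sequences, so it yields an inequality only once one is
   exhibited. *)
have [Gs' sg'] := sigma_exists (aut_act beta' Hs).
have := minb _ autb' _ _ sg sg'; rewrite !total_edgesE.
have [ps cm] := coset_model_exists sg; have [ps' cm'] := coset_model_exists sg'.
have KK j g : Kf (aut_act beta' Hs) j g <-> Kf (aut_act beta Hs) j (Ext (whf D b true) g).
  by rewrite (Kf_aut_act _ _ _ a2) (Kf_aut_act _ _ _ ab).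
have sz : size (aut_act beta' Hs) = size (aut_act beta Hs) by rewrite !size_map.
have lb : nlab b Gs' <= cap D Gs.
  rewrite (nlab_cap (b, false) sg').
  apply: (@cap_le _ _ _ _ _ _ _ _ _ _ _ 1 cm cm' wa sz KK) => w.
  by rewrite invg1 mul1g; apply: (cone_phi_a Db Dnb).
have lc c : c != b -> nlab c Gs' <= nlab c Gs.
  move=> cb; rewrite (nlab_cap (c, false) sg') (nlab_cap (c, false) sg).
  apply: (@cap_le _ _ _ _ _ _ _ _ _ _ _ (if D (c, false) then lt (b, false) else 1)
    cm cm' wa sz KK) => w.
  exact: (cone_phi_c Db Dnb).
rewrite (bigD1 b) //= [X in _ <= X](bigD1 b) //= => le.
have le2 : (\sum_(i | i != b) nlab i Gs' <= \sum_(i | i != b) nlab i Gs)%N by apply: leq_sum.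
lia.
Qed.

Lemma cap_compl (Q : pred (letter B)) Gs : cap (predC Q) Gs = cap Q Gs.
Proof.
apply: eq_count => jx; apply/crossvP/crossvP => -[l [m [/= h1 h2 h3 h4]]].
  by exists m, l; rewrite negbK in h2.
by exists m, l; rewrite /= negbK.
Qed.

(** For an inverse letter the complement of [D] takes the place of [D]. *)
Lemma whitehead_ineq beta (Hs : seq (seq (word B))) Gs (D : pred (letter B)) l :
  gersten beta Hs -> sigma_seq (aut_act beta Hs) Gs -> D l -> ~~ D (linv l) ->
  nlab l.1 Gs <= cap D Gs.
Proof.
move=> gb sg; case: l => b [] Dl Dnl; last exact: whitehead_ineq_pos gb sg Dl Dnl.
rewrite -cap_compl; apply: whitehead_ineq_pos gb sg _ _ => //=.
by rewrite negbK.
Qed.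

End Minimal.

(** * Surgery at a leaf *)

Section Purity.
Variable B : finType.
Local Open Scope group_scope.
Implicit Types (l m a : letter B) (g h k y : fg B) (u : word B).
Implicit Types (X Y : fg B -> bool) (A : pred (letter B)).

Definition pur X l c := exists M, forall g s, val g = l :: s -> M <= len g -> X g = c.

Lemma long_word l M : exists g s, val g = l :: s /\ M <= len g.
Proof.
have rn : red (nseq M.+1 l).
  rewrite /red /=; elim: M => [//|M IH] /=.
  by rewrite eq_sym linv_neq IH.
by exists (fgw (nseq M.+1 l)), (nseq M l); rewrite /len val_fgw_red //= size_nseq leqnSn.
Qed.

Lemma pur_inj X l c c' : pur X l c -> pur X l c' -> c = c'.
Proof.
move=> [M HM] [M' HM']; have [g [s [e lg]]] := long_word l (M + M').
by rewrite -(HM g s e) -?(HM' g s e) //; lia.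
Qed.

Lemma pur_neg X l c : pur (fun w => ~~ X w) l (~~ c) <-> pur X l c.
Proof.
split=> -[M H]; exists M => g s e lg; last by rewrite (H _ _ e lg).
by apply: negb_inj; rewrite (H _ _ e lg).
Qed.

Definition hasc X u c := forall M, exists g s, [/\ val g = u ++ s, M <= len g & X g = c].
Definition impure X u := forall c, hasc X u c.

Lemma not_hasc X u c : ~ hasc X u c ->
  exists M, forall g s, val g = u ++ s -> M <= len g -> X g = ~~ c.
Proof.
move=> /existsNP[M nM]; exists M => g s e lg; apply/eqP; apply: contraT => ne; case: nM.
by exists g, s; split=> //; case: (X g) c ne => -[].
Qed.

Lemma not_pur X l c : ~ pur X l c -> hasc X [:: l] (~~ c).
Proof.
move=> np; apply: contrapT => /not_hasc[M HM]; apply: np; exists M => g s e lg.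
by rewrite (HM g s) ?negbK.
Qed.

Lemma not_impure_pur X l : ~ impure X [:: l] -> exists c, pur X l c.
Proof.
move=> /existsNP[c /not_hasc[M HM]]; exists (~~ c), M => g s e; exact: (HM g s).
Qed.

Lemma hasc_pur X l t c c' : hasc X (l :: t) c -> pur X l c' -> c = c'.
Proof.
move=> H [M HM]; have [g [s [e lg <-]]] := H M.
by rewrite (HM g (t ++ s)).
Qed.

Lemma impure_size X N u : tameN N X -> impure X u -> size u < N.
Proof.
move=> tX im; rewrite ltnNge; apply/negP => le.
have [g [s [e _ h1]]] := im true 0; have [g' [s' [e' _ h2]]] := im false 0.
by rewrite (tameN_prefix tX e le) -(tameN_prefix tX e' le) h2 in h1.
Qed.

Lemma ex_longest (P : word B -> Prop) N : (exists u, P u) ->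
  (forall u, P u -> size u < N) -> exists u, P u /\ forall u', P u' -> size u' <= size u.
Proof.
move=> [u Pu] bd; pose p n := `[< exists2 u, P u & size u = n >].
have ex : exists n, p n by exists (size u); apply/asboolP; exists u.
have ub n : p n -> n <= N by move=> /asboolP[v Pv <-]; apply/ltnW/bd.
case: (ex_maxnP ex ub) => n /asboolP[v Pv <-] mx; exists v; split=> // u' Pu'.
by apply: mx; apply/asboolP; exists u'.
Qed.

(** Pigeonhole on the initial letter; purity then spreads the colour of one long word to its whole
    direction. *)
Lemma colour_letter X A c : (forall l, A l -> exists c, pur X l c) ->
  (forall M, exists g l s, [/\ val g = l :: s, A l, M <= len g & X g = c]) ->
  exists2 l, A l & pur X l c.
Proof.
move=> pA H.
have [l|M HM] := @fin_bound (letter B)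
  (fun l n => A l -> exists c', forall g s, val g = l :: s -> n <= len g -> X g = c').
  have [Al|nA] := boolP (A l); last by exists 0 => n _ Al; case/negP: nA.
  have [c' [M HM]] := pA l Al; exists M => n le _; exists c' => g s e lg.
  by apply: HM e _; apply: leq_trans lg.
have [g [l [s [e Al lg Xg]]]] := H M; exists l => //.
have [c' Hc] := HM l M (leqnn M) Al.
by exists M => g' s' e' lg'; rewrite (Hc g' s') // -(Hc g s).
Qed.

(** The identity is an outermost vertex of the subtree where the colour changes: only the direction
    [a] may still contain both colours. *)
Definition leaf X a := [/\ forall l, l != a -> exists c, pur X l c,
  exists2 l, l != a & pur X l true & exists2 l, l != a & pur X l false].

Definition translate X y := fun w => X (y * w).

(** A direction other than the way back extends the impure prefix, so it is monochromatic by
    maximality; impurity of the prefix itself supplies both colours among these directions. *)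
Lemma leaf_at_longest X u m : impure X (rcons u m) ->
  (forall u', u' != [::] -> impure X u' -> size u' <= size (rcons u m)) ->
  leaf (translate X (fgw (rcons u m))) (linv m).
Proof.
move=> im mx; set v := rcons u m in im mx *; set Xv := translate _ _.
have rv : red v.
  by have [g [s [e _ _]]] := im true 0; have := red_val g; rewrite e => /red_cat[].
have vv : val (fgw v) = v by rewrite val_fgw_red.
have mulv g l s : val g = l :: s -> l != linv m -> val (fgw v * g) = v ++ l :: s.
  exact: val_mul_ext.
have p1 l : l != linv m -> exists c, pur Xv l c.
  move=> nl; have /existsNP[c /not_hasc[M HM]] : ~ impure X (rcons v l).
    move=> im'; have := mx (rcons v l); rewrite !size_rcons ltnn.
    by case: (v) im' => [|? ?] im' /(_ isT im').
  exists (~~ c), M => g s e lg; rewrite /Xv /translate.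
  have e1 := mulv _ _ _ e nl; apply: (HM _ s); first by rewrite e1 cat_rcons.
  by rewrite /len e1 size_cat -e; apply: leq_trans lg (leq_addl _ _).
have p2 c : exists2 l, l != linv m & pur Xv l c.
  apply: colour_letter p1 _ => M.
  have [g [s [e lg Xg]]] := im c (M + size v).+1.
  have rg := red_val g; rewrite e in rg; have [_ rs] := red_cat rg.
  case: s e rg rs => [|l s] e rg rs; first by move: lg; rewrite /len e cats0; lia.
  exists (fgw (l :: s)), l, s; rewrite val_fgw_red //; split=> //.
  - move: rg; rewrite /v cat_rcons => /red_cat[_] /= /andP[//].
  - by move: lg; rewrite /len e size_cat val_fgw_red //=; lia.
  by rewrite /Xv /translate -fgw_cat -e valK_fg.
by split.
Qed.

End Purity.

(** * From a uniquely crossed colouring to a partition of the letters *)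

Section Surgery.
Variable B : finType.
Local Open Scope group_scope.
Variables (Hs : seq (seq (word B))) (Gs : seq (lgraph B)) (ps : nat * nat -> fg B -> Prop).
Hypotheses (cm : coset_model Hs Gs ps).
Hypothesis nlS : forall l : letter B, nlab l.1 Gs = count (fun jx => starv Gs jx l) (verts Gs).
Hypothesis wh : forall (D : pred (letter B)) l, D l -> ~~ D (linv l) -> nlab l.1 Gs <= cap D Gs.
Hypothesis nl2 : forall b : B, 1 < nlab b Gs.
Implicit Types (l m a : letter B) (g h k y : fg B) (X : fg B -> bool).

Definition uniq_cross X := forall j j' g g', j < size Hs -> j' < size Hs ->
  crosses (sconj (Kf Hs j) g) X -> crosses (sconj (Kf Hs j') g') X ->
  j = j' /\ Kf Hs j (g * g'^-1).

Lemma crosses_neg K X : crosses K (fun w => ~~ X w) <-> crosses K X.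
Proof.
rewrite /crosses; have -> : (fun w => ~~ ~~ X w) = X by apply: funext => w; rewrite negbK.
by split=> -[].
Qed.

Lemma uniq_cross_neg X : uniq_cross X -> uniq_cross (fun w => ~~ X w).
Proof. by move=> uX j j' g g' lj lj' /crosses_neg c1 /crosses_neg c2; apply: uX. Qed.

Lemma crosses_translate K X y g : tame X ->
  crosses (sconj K g) (translate X y) <-> crosses (sconj K (g * y^-1)) X.
Proof. by move=> tX; rewrite -(crosses_sconj _ y tX) sconjM mulgVK. Qed.

Lemma uniq_cross_translate X y : tame X -> uniq_cross X -> uniq_cross (translate X y).
Proof.
move=> tX uX j j' g g' lj lj'; rewrite !crosses_translate // => c1 c2.
have [-> H] := uX _ _ _ _ lj lj' c1 c2; split=> //.
by move: H; rewrite invgM invgK mulgA mulgVK.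
Qed.

Lemma cm_index jx : jx \in verts Gs -> jx.1 < size Hs.
Proof. by case: jx => j x; rewrite mem_verts (cm_size cm) => /andP[]. Qed.

Lemma pur_meets K X l c : pur X l c -> star K l -> meets K (fun w => X w == c).
Proof.
move=> [M HM]; apply: (@meets_mono _ M) => g lg; rewrite /cone.
by case e: (val g) => [//|l' s] /= /eqP el; subst l'; rewrite (HM g s).
Qed.

Lemma pur_crosses X jx g l m : ps jx g -> pur X l true -> pur X m false ->
  starv Gs jx l -> starv Gs jx m -> crosses (sconj (Kf Hs jx.1) g) X.
Proof.
move=> pg pl pm /(cm_star cm _ pg) sl /(cm_star cm _ pg) sm; split.
  by apply: (@meets_mono _ 0) (pur_meets pl sl) => h _ /eqP.
by apply: (@meets_mono _ 0) (pur_meets pm sm) => h _ /eqP->.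
Qed.

Definition purb X l c := `[< pur X l c >].
(** A certificate of crossing visible on the edges at one vertex; [uniq_cross] allows at most one
    vertex to have it. *)
Definition splits X jx :=
  [exists l : letter B, purb X l true && starv Gs jx l] &&
  [exists l : letter B, purb X l false && starv Gs jx l].

Lemma splitsP X jx : reflect
  (exists l m, [/\ pur X l true, pur X m false, starv Gs jx l & starv Gs jx m]) (splits X jx).
Proof.
apply: (iffP andP) => [[/existsP[l /andP[/asboolP pl sl]] /existsP[m /andP[/asboolP pm sm]]]|].
  by exists l, m.
case=> l [m [pl pm sl sm]]; split; apply/existsP; [exists l|exists m].
  by rewrite sl andbT; apply/asboolP.
by rewrite sm andbT; apply/asboolP.
Qed.

Lemma splits_crosses X jx g : ps jx g -> splits X jx -> crosses (sconj (Kf Hs jx.1) g) X.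
Proof. by move=> pg /splitsP[l [m [pl pm sl sm]]]; apply: pur_crosses pl pm sl sm. Qed.

Lemma count_splits X : uniq_cross X -> count (splits X) (verts Gs) <= 1.
Proof.
move=> uX; rewrite leqNgt; apply/negP => /(count_gt1 (uniq_verts Gs)).
case=> -[j x] [[j' x'] [ne i1 i2 s1 s2]].
have [g pg] := cm_ex cm i1; have [g' pg'] := cm_ex cm i2.
have [/= ej] := uX _ _ _ _ (cm_index i1) (cm_index i2)
   (splits_crosses pg s1) (splits_crosses pg' s2).
subst j' => /(cm_eq cm pg pg') ex; by rewrite ex eqxx in ne.
Qed.

Lemma cap_splits_le X (C : pred (letter B)) : uniq_cross X ->
  {in verts Gs, forall jx, crossv Gs C jx -> splits X jx} -> cap C Gs <= 1.
Proof.
move=> uX sub; apply: leq_trans (count_splits uX).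
rewrite /cap -!size_filter; apply: uniq_leq_size; first by rewrite filter_uniq // uniq_verts.
by move=> jx; rewrite !mem_filter => /andP[c i]; rewrite i sub.
Qed.

Lemma cap1_closed (C : pred (letter B)) l : cap C Gs <= 1 -> C l -> C (linv l).
Proof.
move=> c1 Cl; apply: contraT => nC; have := leq_trans (wh Cl nC) c1.
by rewrite leqNgt nl2.
Qed.

Definition sideb X a c l := (l != a) && purb X l c.

Lemma sidebP X a c l : reflect (l != a /\ pur X l c) (sideb X a c l).
Proof. by apply: (iffP andP) => -[? /asboolP]. Qed.

Lemma leaf_side X a l : leaf X a -> l != a -> sideb X a true l \/ sideb X a false l.
Proof.
by case=> p _ _ nl; have [[] pc] := p l nl; [left|right]; apply/sidebP.
Qed.

Lemma side_splits X a jx l m : sideb X a true l -> sideb X a false m ->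
  starv Gs jx l -> starv Gs jx m -> splits X jx.
Proof. by move=> /sidebP[_ pl] /sidebP[_ pm] sl sm; apply/splitsP; exists l, m. Qed.

(** This excludes the vertices that meet both sides but not [a]: they would contribute to [cap] of a
    side without being counted by [n(a)]. *)
Definition good X a := forall jx, jx \in verts Gs ->
  (exists l m, [/\ sideb X a true l, sideb X a false m, starv Gs jx l & starv Gs jx m]) ->
  starv Gs jx a.

(* The Whitehead inequality for the side containing [a^-1] leaves no vertex whose
   directions are [a] together with directions of the other side only. *)
Lemma good_leaf X a : leaf X a -> uniq_cross X -> good X a -> sideb X a false (linv a) ->
  cap (sideb X a true) Gs <= 1 /\
  forall jx, jx \in verts Gs -> starv Gs jx a ->
    exists2 m, sideb X a false m & starv Gs jx m.
Proof.
move=> lf uX gd Ca.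
pose P1 jx := [exists l : letter B, sideb X a true l && starv Gs jx l].
pose P2 jx := [exists l : letter B, sideb X a false l && starv Gs jx l].
have sp jx : P1 jx -> P2 jx -> splits X jx /\
  exists l m, [/\ sideb X a true l, sideb X a false m, starv Gs jx l & starv Gs jx m].
  move=> /existsP[l /andP[c1 s1]] /existsP[m /andP[c2 s2]]; split; last by exists l, m.
  exact: side_splits c1 c2 s1 s2.
have nf : ~~ sideb X a false (linv (linv a)) by rewrite linvK /sideb eqxx.
have := wh Ca nf; rewrite (nlS a) /cap => W.
have AP2 : {in verts Gs, forall jx, starv Gs jx a -> P2 jx}.
  (* A crossing vertex has an edge outside the false side: it is [a] itself, or it lies in the true
     side and then [good] supplies [a]. *)
  have le : count (crossv Gs (sideb X a false)) (verts Gs) <=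
      count (fun jx => starv Gs jx a && P2 jx) (verts Gs).
    rewrite -!size_filter; apply: uniq_leq_size; first by rewrite filter_uniq // uniq_verts.
    move=> jx; rewrite !mem_filter => /andP[/crossvP[l [m [Cl Cm sl sm]]] i].
    have p2 : P2 jx by apply/existsP; exists l; rewrite Cl.
    rewrite i p2 !andbT; have [<-//|nm] := eqVneq m a.
    have [c1|c2] := leaf_side lf nm; last by rewrite c2 in Cm.
    have p1 : P1 jx by apply/existsP; exists m; rewrite c1.
    by have [_ e] := sp _ p1 p2; apply: gd.
  (* The two bounds squeeze, so every vertex counted by [n(a)] satisfies [P2]. *)
  have z : count (fun jx => starv Gs jx a && ~~ P2 jx) (verts Gs) = 0.
    have := count_predUI (fun jx => starv Gs jx a && P2 jx)
                         (fun jx => starv Gs jx a && ~~ P2 jx) (verts Gs).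
    rewrite (eq_count (a1 := predU _ _) (a2 := fun jx => starv Gs jx a)); last first.
      by move=> jx /=; case: (starv _ _ _); case: (P2 jx).
    rewrite (eq_count (a1 := predI _ _) (a2 := pred0)); last first.
      by move=> jx /=; case: (starv _ _ _); case: (P2 jx).
    by rewrite count_pred0; have := leq_trans W le; lia.
  move=> jx i sa; apply: contraT => n2; move/eqP: z; rewrite -leqn0 leqNgt -has_count.
  by case/hasP; exists jx; rewrite ?sa.
split; last first.
  by move=> jx i sa; have /existsP[m /andP[]] := AP2 jx i sa; exists m.
apply: cap_splits_le uX _ => jx i /crossvP[l [m [Cl Cm sl sm]]].
have p1 : P1 jx by apply/existsP; exists l; rewrite Cl.
suff p2 : P2 jx by case: (sp _ p1 p2).
have [em|nm] := eqVneq m a; first by apply: AP2 => //; rewrite -em.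
have [c1|c2] := leaf_side lf nm; first by rewrite c1 in Cm.
by apply/existsP; exists m; rewrite c2.
Qed.

Definition allpure X := [/\ forall l, exists c, pur X l c, exists l, pur X l true &
  exists l, pur X l false].

Lemma allpure_cap X : allpure X -> uniq_cross X -> cap (fun l => purb X l true) Gs <= 1.
Proof.
move=> [ap _ _] uX; apply: cap_splits_le uX _ => jx i /crossvP[l [m [/asboolP Cl Cm sl sm]]].
apply/splitsP; exists l, m; split=> //; have [[] pc //] := ap m.
by case/negP: Cm; apply/asboolP.
Qed.

Lemma good_neg X a : good X a -> good (fun w => ~~ X w) a.
Proof.
have E c l : sideb (fun w => ~~ X w) a c l = sideb X a (~~ c) l.
  by rewrite /sideb; congr (_ && _); apply: asbool_equiv_eq; rewrite -(pur_neg X) negbK.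
by move=> gd jx i [l [m []]]; rewrite !E /= => cl cm' sl sm; apply: gd => //; exists m, l.
Qed.

Lemma leaf_neg X a : leaf X a -> leaf (fun w => ~~ X w) a.
Proof.
case=> p [l nl pl] [m nm pm]; split.
- by move=> k /p[c pc]; exists (~~ c); apply/pur_neg.
- by exists m => //; apply/(pur_neg X m false).
by exists l => //; apply/(pur_neg X l true).
Qed.

Definition essential X := forall c M, exists2 g, M <= len g & X g = c.

(** Failure at the first leaf provides a split vertex with an edge [l] different from [a1]. By
    uniqueness, a vertex split at the second leaf is a translate of the same coset, and from there
    [l] lies in the direction back, [m^-1]. *)
Lemma two_leaves X a1 u m : tame X -> uniq_cross X -> leaf X a1 ->
  head m u = a1 -> val (fgw (rcons u m)) = rcons u m ->
  ~ good X a1 -> good (translate X (fgw (rcons u m))) (linv m).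
Proof.
move=> tX uX lf hd vv ng; set y := fgw _; set X2 := translate _ _.
have [jx1 [i1 [l [l' [cl cl' sl sl']]]]] : exists jx, jx \in verts Gs /\
  exists l m, [/\ sideb X a1 true l, sideb X a1 false m, starv Gs jx l & starv Gs jx m].
  apply: contrapT => no; apply: ng => jx i e.
  by exfalso; apply: no; exists jx.
have s1 := side_splits cl cl' sl sl'; have /sidebP[nl _] := cl.
move=> jx2 i2 [k [k' [ck ck' sk sk']]]; have s2 := side_splits ck ck' sk sk'.
have [g1 p1] := cm_ex cm i1; have [g2 p2] := cm_ex cm i2.
have c1 := splits_crosses p1 s1; have := splits_crosses p2 s2.
rewrite crosses_translate // => c2.
have [ej Kg] := uX _ _ _ _ (cm_index i2) (cm_index i1) c2 c1.
apply/(cm_star cm _ p2).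
have := @star_sconj_last _ (sconj (Kf Hs jx2.1) (g2 * y^-1)) l y u m.
rewrite sconjM mulgVK; apply=> //; last by rewrite hd eq_sym.
have -> : sconj (Kf Hs jx2.1) (g2 * y^-1) = sconj (Kf Hs jx2.1) g1.
  by rewrite -(mulgVK g1 (g2 * y^-1)) sconj_mem //; apply: Ksub_subgroup.
by rewrite ej; apply/(cm_star cm _ p1).
Qed.

(** The leaf at a longest impure prefix is taken if it is [good]; otherwise a second leaf is found
    by looking from it in its only impure direction, and [two_leaves] applies. *)
Lemma surgery X : tame X -> essential X -> uniq_cross X -> exists y,
  let Y := translate X y in
  allpure Y \/ exists a, [/\ leaf Y a, good Y a & forall c, ~ pur Y a c].
Proof.
move=> tX es uX.
(* Without a nonempty impure prefix every direction at the identity is already monochromatic. *)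
have [[u0 [nu0 iu0]]|no] := pselect (exists u, u != [::] /\ impure X u); last first.
  have ap l : exists c, pur X l c.
    by apply: not_impure_pur => im; apply: no; exists [:: l].
  have col c : exists l, pur X l c.
    have [//|M|l _ pl] := @colour_letter _ X predT c; last by exists l.
    have [g lg Xg] := es c M.+1; case e: (val g) => [|l s]; first by move: lg; rewrite /len e.
    by exists g, l, s; split=> //; apply: ltnW.
  exists 1; left; have -> : translate X 1 = X by apply: funext => w; rewrite /translate mul1g.
  by split.
have longest Z : tame Z -> (exists u, u != [::] /\ impure Z u) -> exists u m,
    impure Z (rcons u m) /\ forall u', u' != [::] -> impure Z u' -> size u' <= size (rcons u m).
  move=> [N tZ] ex; have [|v [[nv im] mx]] := @ex_longest _ (fun u => u != [::] /\ impure Z u) N ex.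
    by move=> u [_ im]; apply: impure_size tZ im.
  case/lastP: v nv im mx => [//|v m] _ im mx; exists v, m; split=> // u' n i; exact: mx.
have [u1 [m1 [im1 mx1]]] : exists u m, impure X (rcons u m) /\
  forall u', u' != [::] -> impure X u' -> size u' <= size (rcons u m).
  by apply: longest => //; exists u0.
set y1 := fgw (rcons u1 m1); set a1 := linv m1; pose X1 := translate X y1.
have lf1 : leaf X1 a1 by apply: leaf_at_longest.
have tX1 : tame X1 by apply: tame_translate.
have uX1 : uniq_cross X1 by apply: uniq_cross_translate.
have [p1 [lt1 nlt1 pt1] [lf1' nlf1 pf1]] := lf1.
have [[c pc]|np] := pselect (exists c, pur X1 a1 c).
  exists y1; left; split; [|by exists lt1|by exists lf1'].
  by move=> l; have [->|/p1//] := eqVneq l a1; exists c.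
have ima : impure X1 [:: a1].
  by move=> c; rewrite -(negbK c); apply: not_pur => pc; apply: np; exists (~~ c).
have [gd|ngd] := pselect (good X1 a1).
  by exists y1; right; exists a1; split=> // c pc; apply: np; exists c.
have [u2 [m2 [im2 mx2]]] : exists u m, impure X1 (rcons u m) /\
  forall u', u' != [::] -> impure X1 u' -> size u' <= size (rcons u m).
  by apply: longest => //; exists [:: a1].
(* All directions other than [a1] are pure, so an impure prefix starts with [a1]. *)
have hd2 : head m2 u2 = a1.
  apply/eqP; apply: contraT => /p1[c pc].
  have H l t : impure X1 (l :: t) -> pur X1 l c -> False.
    by move=> im /(hasc_pur (im (~~ c))) /eqP; case: (c).
  by case: u2 im2 {mx2} pc => [|l t] /= /H.
have rv : red (rcons u2 m2).
  by have [g [s [e _ _]]] := im2 true 0; have := red_val g; rewrite e => /red_cat[].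
have vv : val (fgw (rcons u2 m2)) = rcons u2 m2 by rewrite val_fgw_red.
set y2 := fgw (rcons u2 m2) in vv *.
have E : translate X (y1 * y2) = translate X1 y2.
  by apply: funext => w; rewrite /X1 /translate mulgA.
exists (y1 * y2); right; exists (linv m2); rewrite E; split.
- exact: leaf_at_longest.
- exact: (two_leaves tX1 uX1 lf1).
move=> c [M HM].
(* The way back from the second leaf contains the pure directions of both colours at the first leaf,
   so it is not pure. *)
have [l nl [M' pl]] : exists2 l, l != a1 & pur X1 l (~~ c).
  by case: (c); [exists lf1'|exists lt1].
have [g [s [e lg]]] := long_word l (M + M' + len y2).
have eg : val (y2^-1 * g) = linv m2 :: (winv u2 ++ l :: s).
  by apply: val_divl => //; rewrite hd2 eq_sym.
have := HM _ _ eg; rewrite /translate mulVKg (pl g s) //; last by lia.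
move=> H; have : ~~ c = c; last by case: (c).
apply: H; apply: len_mull_ge; rewrite lenV; lia.
Qed.

(** If all directions are pure, [C] is one colour class. At a leaf, [C] is the side that omits
    [a^-1]; negating the colouring puts [a^-1] on the false side. *)
Lemma surgery_cleaves X : tame X -> essential X -> uniq_cross X ->
  exists C : pred (letter B), [/\ cap C Gs <= 1, forall l, C l -> C (linv l),
    exists l, C l & exists l, ~~ C l].
Proof.
move=> tX es uX; have [y] := surgery tX es uX; set Y := translate X y.
have uY : uniq_cross Y by apply: uniq_cross_translate.
move=> /= [ap|[a [lf gd _]]].
  have c1 := allpure_cap ap uY; exists (fun l => purb Y l true); split=> //.
  - by move=> l; apply: (cap1_closed c1).
  - by have [_ [l pl] _] := ap; exists l; apply/asboolP.
  have [_ _ [l pl]] := ap; exists l; apply/asboolP => pl'.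
  by have := pur_inj pl pl'.
have aux Z : leaf Z a -> good Z a -> uniq_cross Z -> sideb Z a false (linv a) ->
  exists C : pred (letter B), [/\ cap C Gs <= 1, forall l, C l -> C (linv l),
    exists l, C l & exists l, ~~ C l].
  move=> lfZ gdZ uZ s; have [c1 _] := good_leaf lfZ uZ gdZ s.
  exists (sideb Z a true); split=> //.
  - by move=> l; apply: (cap1_closed c1).
  - by have [_ [l nl pl] _] := lfZ; exists l; apply/sidebP.
  by exists a; rewrite /sideb eqxx.
have [s|s] := leaf_side lf (linv_neq a); last exact: aux s.
apply: (aux _ (leaf_neg lf) (good_neg gd) (uniq_cross_neg uY)).
by case/sidebP: s => n p; apply/sidebP; split=> //; apply/(pur_neg Y _ true).
Qed.

End Surgery.

(** * Nonseparating spheres *)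

Section Parity.
Variable T : eqType.
Implicit Types (P Q : T -> bool) (b c : bool).

(** A relation rather than a function, since an infinite set has no parity. *)
Definition parity P b := exists s : seq T,
  [/\ uniq s, forall x, (x \in s) = P x & odd (size s) = b].

Lemma parity_inj P b c : parity P b -> parity P c -> b = c.
Proof.
move=> [s [us ms <-]] [t [ut mt <-]]; congr odd; apply: perm_size.
by apply: uniq_perm => // x; rewrite ms mt.
Qed.

Lemma eq_parity P Q b : P =1 Q -> parity P b -> parity Q b.
Proof. by move=> e [s [us ms os]]; exists s; split=> // x; rewrite ms e. Qed.

Lemma parity0 : parity (fun=> false) false.
Proof. by exists [::]. Qed.

Lemma parity1 x : parity (pred1 x) true.
Proof. by exists [:: x]; split=> // y; rewrite inE. Qed.

Lemma parity_add P Q b c : parity P b -> parity Q c ->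
  parity (fun x => P x (+) Q x) (b (+) c).
Proof.
move=> [s [us ms <-]] [t [ut mt <-]].
exists ([seq x <- s | x \notin t] ++ [seq x <- t | x \notin s]); split.
- rewrite cat_uniq !filter_uniq //= andbT; apply/hasPn => x.
  by rewrite !mem_filter => /andP[/negbTE-> _]; rewrite andbF.
- by move=> x; rewrite mem_cat !mem_filter ms mt; case: (P x); case: (Q x).
have e : count (mem t) s = count (mem s) t.
  rewrite -!size_filter; apply: perm_size; apply: uniq_perm; rewrite ?filter_uniq //.
  by move=> x; rewrite !mem_filter /= andbC.
rewrite size_cat !size_filter oddD.
have := count_predC (mem t) s; have := count_predC (mem s) t; rewrite e => <- <-.
by rewrite !oddD; case: (odd (count (mem s) t)); do 2!case: (odd _).
Qed.

Lemma parity_reindex f f' P b : cancel f f' -> cancel f' f -> parity P b ->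
  parity (fun x => P (f x)) b.
Proof.
move=> fK f'K [s [us ms os]]; exists (map f' s); split.
- by rewrite map_inj_uniq //; apply: can_inj f'K.
- by move=> x; rewrite -{1}(fK x) (mem_map (can_inj f'K)).
- by rewrite size_map.
Qed.

End Parity.

(** * Colourings trivial in homology mod 2 *)

Section Separating.
Variable B : finType.
Local Open Scope group_scope.
Implicit Types (l m a : letter B) (g h y v w : fg B) (X Y Z : fg B -> bool).

(* The sphere dual to [X] is null-homologous mod 2. *)
Definition Sep X := forall g, parity (fun w => X w (+) X (w * g)) false.

Lemma Sep_translate X y : Sep (translate X y) -> Sep X.
Proof.
move=> S g; have := parity_reindex (mulVKg y) (mulKg y) (S g).
by apply: eq_parity => w; rewrite /translate mulVKg !mulgA mulgV mul1g.
Qed.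

Lemma Sep_add X Y : Sep X -> Sep Y -> Sep (fun w => X w (+) Y w).
Proof.
move=> SX SY g; have := parity_add (SX g) (SY g); apply: eq_parity => w.
by rewrite -!addbA; congr (_ (+) _); rewrite addbCA.
Qed.

Lemma Sep_neg X : Sep (fun w => ~~ X w) -> Sep X.
Proof. by move=> S g; apply: eq_parity (S g) => w; case: (X w); case: (X _). Qed.

Fixpoint ballw n : seq (word B) :=
  if n is n'.+1 then [::] :: [seq l :: u | l <- enum {: letter B}, u <- ballw n']
  else [:: [::]].
Definition ball n : seq (fg B) := map (@fgw B) (ballw n).

Lemma mem_ball n g : len g <= n -> g \in ball n.
Proof.
move=> lg; apply/mapP; exists (val g); last by rewrite valK_fg.
move: lg; rewrite /len; elim: n (val g) => [|n IH] [|l w] //= lw.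
by rewrite inE; apply/orP; right; apply: allpairs_f; rewrite ?mem_enum ?IH.
Qed.

(** Translation preserves the parity of a finite set, so the two contributions cancel. *)
Lemma Sep_fin X : (exists M, forall g, M <= len g -> X g = false) -> Sep X.
Proof.
move=> [M HM] g.
have [b pb] : exists b, parity X b.
  exists (odd (size (undup (filter X (ball M))))), (undup (filter X (ball M))).
  split=> //; first exact: undup_uniq.
  move=> w; rewrite mem_undup mem_filter; case Xw: (X w) => //=.
  by apply: mem_ball; rewrite leqNgt; apply/negP => /ltnW/HM; rewrite Xw.
have pb' := parity_reindex (mulgK g) (mulgVK g) pb.
by rewrite -(addbb b); apply: parity_add.
Qed.

Lemma Sep_close X Y : (exists M, forall g, M <= len g -> X g = Y g) -> Sep Y -> Sep X.
Proof.
move=> [M HM] SY.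
have SF : Sep (fun w => X w (+) Y w) by apply: Sep_fin; exists M => g /HM->; rewrite addbb.
by move=> g; apply: eq_parity (Sep_add SF SY g) => w; rewrite !addbK.
Qed.

(** When [C] contains [l] and [l^-1], the colours of [w] and [w l] differ exactly for [w = 1] and
    [w = l^-1], an even number; a general [g] is treated letter by letter. *)
Lemma Sep_cone (C : pred (letter B)) : (forall l, C l -> C (linv l)) -> Sep (cone C).
Proof.
move=> Cl; have CE l : C (linv l) = C l.
  by apply/idP/idP => /Cl //; rewrite linvK.
have S1 l : parity (fun w => cone C w (+) cone C (w * lt l)) false.
  have [cl|ncl] := boolP (C l); last first.
    apply: eq_parity (parity0 _) => w; rewrite cone_rec CE (negbTE ncl) !andbF.
    by rewrite !addbF addbb.
  apply: (@eq_parity _ (fun w => (w == 1) (+) (w == (lt l)^-1))).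
    by move=> w; rewrite cone_rec CE cl !andbT mulg_eq1 -addbA addKb.
  by rewrite -(addbb true); apply: parity_add; apply: parity1.
move=> g; elim/fg_ind: g => [|g l IH].
  by apply: eq_parity (parity0 _) => w; rewrite mulg1 addbb.
have S2 := parity_reindex (mulgK g) (mulgVK g) (S1 l).
have := parity_add IH S2; apply: eq_parity => w.
by rewrite -addbA addKb mulgA.
Qed.

(** For the element that [f] maps to [b], the colour changes at [w = 1] only, an odd number of
    places. *)
Lemma not_Sep_letter f f' b : auto f f' ->
  ~ Sep (fun w => cone (pred1 (b, false)) (f w)).
Proof.
move=> [fM f'M fK f'K] /(_ (f' (lt (b, false)))) p0.
suff p1 : parity (fun w => cone (pred1 (b, false)) (f w) (+)
    cone (pred1 (b, false)) (f (w * f' (lt (b, false))))) true.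
  by have := parity_inj p0 p1.
apply: eq_parity (parity1 (1 : fg B)) => w.
rewrite fM f'K cone_a addKb /= -{2}(morph1 fM) (inj_eq (can_inj fK)) //.
Qed.

Lemma pur_bound X (A : pred (letter B)) (c : letter B -> bool) :
  (forall l, A l -> pur X l (c l)) ->
  exists M, forall g l s, val g = l :: s -> A l -> M <= len g -> X g = c l.
Proof.
move=> H; have [l|M HM] := @fin_bound (letter B)
  (fun l n => A l -> forall g s, val g = l :: s -> n <= len g -> X g = c l).
  have [Al|nA] := boolP (A l); last by exists 0 => n _ Al; case/negP: nA.
  have [M HM] := H l Al; exists M => n le _ g s e lg.
  by apply: HM e _; apply: leq_trans lg.
by exists M => g l s e Al; apply: (HM l M (leqnn M) Al g s e).
Qed.

(* The vertices of the finite subtree of the Cayley tree in which the colour of [X]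
   changes; their number decreases under surgery. *)
Definition branch X v := forall l c, ~ forall l', l' != l -> pur (translate X v) l' c.

Lemma translateM X y v : translate (translate X y) v = translate X (y * v).
Proof. by apply: funext => w; rewrite /translate mulgA. Qed.

Lemma branch_translate X y v : branch (translate X y) v <-> branch X (y * v).
Proof. by rewrite /branch translateM. Qed.

Lemma branch_neg X v : branch (fun w => ~~ X w) v -> branch X v.
Proof. by move=> b l c H; apply: (b l (~~ c)) => l' nl; apply/(pur_neg (translate X v)); apply: H. Qed.

(** Far from the identity all directions except the way back have the colour of the vertex
    itself. *)
Lemma branch_finite X : tame X ->
  exists L : seq (fg B), forall v, branch X v -> v \in L.
Proof.
move=> [N tX]; exists (ball N) => v bv; apply: mem_ball; rewrite leqNgt; apply/negP => lv.
case/lastP E: (val v) => [|u m]; first by move: lv; rewrite /len E.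
apply: (bv (linv m) (X v)) => l' nl; exists 0 => g s e _; rewrite /translate.
rewrite (tameN_prefix tX (val_mul_ext E e nl)); last by rewrite -E ltnW.
by rewrite -E valK_fg.
Qed.

End Separating.

(** * Induction on the number of branch vertices *)

Section Induction.
Variable B : finType.
Local Open Scope group_scope.
Variables (Hs : seq (seq (word B))) (Gs : seq (lgraph B)) (ps : nat * nat -> fg B -> Prop).
Hypotheses (cm : coset_model Hs Gs ps).
Hypothesis nlS : forall l : letter B, nlab l.1 Gs = count (fun jx => starv Gs jx l) (verts Gs).
Hypothesis wh : forall (D : pred (letter B)) l, D l -> ~~ D (linv l) -> nlab l.1 Gs <= cap D Gs.
Hypothesis nl2 : forall b : B, 1 < nlab b Gs.
Implicit Types (l m a : letter B) (g h y v w : fg B) (X Z : fg B -> bool).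

(** The surgery: the true side at the leaf is erased and only the part in direction [a] is kept. *)
Definition restrict Z a := fun w => Z w && cone (pred1 a) w.

Section Restrict.
Variables (Z : fg B -> bool) (a : letter B).
Hypotheses (lf : leaf Z a) (np : forall c, ~ pur Z a c).

(** At [1] only the direction [a] can keep the colour [true], so [1] is no longer a branch vertex.
    At a vertex beyond [a] only the way back has changed, and in [Z] it already contained both
    colours. *)
Lemma restrict_branch v : branch (restrict Z a) v -> v != 1 /\ branch Z v.
Proof.
move=> bv; have v1 : v != 1.
  apply/eqP => e; subst v; apply: (bv a false) => l' nl; exists 0 => g s e _.
  by rewrite /translate mul1g /restrict /cone e /= (negbTE nl) andbF.
split=> // l c H; case/lastP E: (val v) v1 => [|u m] v1.
  by case/eqP: v1; apply: val_inj.
(* [head m u] is the first letter of [v]; when it is not [a], all directions but the way back are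
   erased. *)
have [ha|nh] := eqVneq (head m u) a; last first.
  apply: (bv (linv m) false) => l' nl; exists 0 => g s e _.
  rewrite /translate /restrict /cone (val_mul_ext E e nl).
  by case: (u) nh => [|n t] /= /negbTE->; rewrite andbF.
have [el|nl] := eqVneq l (linv m).
  apply: (bv (linv m) c) => l' nl; rewrite -el in nl; have [M HM] := H _ nl.
  exists M => g s e lg; rewrite -(HM g s e lg) /translate /restrict /cone.
  rewrite el in nl; rewrite (val_mul_ext E e nl).
  by case: (u) ha => [|n t] /= ->; rewrite eqxx andbT.
have [M HM] : pur (translate Z v) (linv m) c by apply: H; rewrite eq_sym.
have [_ [l1 n1 p1] [l2 n2 p2]] := lf.
have [l' nl' [M' pl]] : exists2 l', l' != a & pur Z l' (~~ c).
  by case: (c); [exists l2|exists l1].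
have [g [s [e lg]]] := long_word l' (M + M' + len v).
have hl : head m u != l' by rewrite ha eq_sym.
have := HM _ _ (val_divl E e hl); rewrite /translate mulVKg (pl g s) //; last by lia.
move=> K; have : ~~ c = c; last by case: (c).
by apply: K; apply: len_mull_ge; rewrite lenV; lia.
Qed.

Lemma leaf_branch : branch Z 1.
Proof.
have tr : translate Z 1 = Z by apply: funext => w; rewrite /translate mul1g.
move=> l c; rewrite tr => H; have [e|nl] := eqVneq l a.
  subst l; have [_ [l1 n1 p1] [l2 n2 p2]] := lf.
  by have := pur_inj p1 (H _ n1); have := pur_inj p2 (H _ n2) => <-.
by apply: (np (H a _)); rewrite eq_sym.
Qed.

Lemma side_bound : exists M, forall g l s, val g = l :: s -> l != a -> M <= len g ->
  Z g = sideb Z a true l.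
Proof.
apply: pur_bound => l nl; have [p _ _] := lf; have [[] pc] := p l nl.
  by rewrite (_ : sideb Z a true l); last by apply/sidebP.
rewrite (_ : sideb Z a true l = false) //; apply/sidebP => -[_ pt].
by have := pur_inj pc pt.
Qed.

Lemma restrict_essential : essential (restrict Z a).
Proof.
have [_ [l nl _] _] := lf; move=> [] M.
  have [g [s [e lg Zg]]] := not_pur (np (c := false)) M; exists g => //.
  by rewrite /restrict Zg /cone e /= eqxx.
have [g [s [e lg]]] := long_word l M; exists g => //.
by rewrite /restrict /cone e /= (negbTE nl) andbF.
Qed.

(** A group crossing the restriction has long elements in direction [a]. If it had none of colour
    [false], it would also have a true direction, and the vertex so obtained has an edge [a], hence
    by hypothesis a false direction. *)
Lemma restrict_uniq_cross : uniq_cross Hs Z ->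
  (forall jx, jx \in verts Gs -> starv Gs jx a ->
    exists2 m, sideb Z a false m & starv Gs jx m) ->
  uniq_cross Hs (restrict Z a).
Proof.
move=> uZ H.
suff cr j g : j < size Hs -> crosses (sconj (Kf Hs j) g) (restrict Z a) ->
    crosses (sconj (Kf Hs j) g) Z.
  by move=> j j' g g' lj lj' /(cr _ _ lj) c1 /(cr _ _ lj') c2; apply: uZ.
move=> lj [m1 m2]; split; first by apply: (@meets_mono _ 0) m1 => w _ /andP[].
apply: contrapT => nm.
have [M HM] := side_bound.
have : meets (sconj (Kf Hs j) g) (fun w => ~~ Z w || cone (sideb Z a true) w).
  apply: (@meets_mono _ M.+1) m2 => w lw; rewrite /restrict.
  case Zw: (Z w) => //=; rewrite /cone; case e: (val w) => [|l s]; first by move: lw; rewrite /len e.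
  by move=> /= nl; rewrite -(HM w l s) // ltnW.
case/meets_or => // /meets_cone[l1 /sidebP[n1 _] s1].
have sa : star (sconj (Kf Hs j) g) a by apply: (@meets_mono _ 0) m1 => w _ /andP[].
have [x ix px] := cm_pos cm lj n1 s1 sa.
have [|m /sidebP[_ pm] /(cm_star cm _ px) sm] := H (j, x) ix.
  by apply/(cm_star cm _ px).
apply: nm; by apply: (@meets_mono _ 0) (pur_meets pm sm) => w _ /eqP->.
Qed.

(** Far from the identity [Z] is the sum of the restriction and the cone on the true side, and
    [Sep_cone] handles the latter. *)
Lemma restrict_Sep : (forall l, sideb Z a true l -> sideb Z a true (linv l)) ->
  Sep (restrict Z a) -> Sep Z.
Proof.
move=> cl SR; apply: (@Sep_close _ _ (fun w => restrict Z a w (+) cone (sideb Z a true) w)).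
  have [M HM] := side_bound; exists M.+1 => g lg; rewrite /restrict /cone.
  case e: (val g) => [|l s] /=; first by move: lg; rewrite /len e.
  have [el|nl] := eqVneq l a; first by rewrite andbT /sideb el eqxx addbF.
  by rewrite andbF /= (HM g l s) // ltnW.
exact: Sep_add SR (Sep_cone cl).
Qed.

End Restrict.

Lemma allpure_Sep X : allpure X -> uniq_cross Hs X -> Sep X.
Proof.
move=> ap uX; have c1 := allpure_cap cm ap uX.
have [M HM] : exists M, forall g l s, val g = l :: s -> predT l -> M <= len g ->
    X g = purb X l true.
  apply: pur_bound => l _; have [p _ _] := ap; have [[] pc] := p l.
    by rewrite (_ : purb X l true) //; apply/asboolP.
  rewrite (_ : purb X l true = false) //; apply/asboolP => pt.
  by have := pur_inj pc pt.
apply: (@Sep_close _ _ (cone (fun l => purb X l true))); last first.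
  by apply: Sep_cone => l; apply: (cap1_closed wh nl2 c1).
exists M.+1 => g lg; rewrite /cone; case e: (val g) => [|l s].
  by move: lg; rewrite /len e.
by apply: (HM g l s e isT); apply: ltnW.
Qed.

(** [L] contains the branch vertices. Surgery moves a leaf to [1], and the restriction loses the
    branch vertex [1] and gains none, so the list shrinks. *)
Lemma uniq_cross_Sep n X (L : seq (fg B)) : size L < n -> tame X -> essential X ->
  uniq_cross Hs X -> (forall v, branch X v -> v \in L) -> Sep X.
Proof.
elim: n X L => [//|n IH] X L sL tX es uX bL.
have [y] := surgery cm tX es uX; set Y := translate X y => /= dich.
have uY : uniq_cross Hs Y by apply: uniq_cross_translate.
have tY : tame Y by apply: tame_translate.
apply: (@Sep_translate _ _ y); rewrite -/Y.
case: dich => [ap|[a [lfY gdY npY]]]; first exact: allpure_Sep.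
have bY v : branch Y v -> v \in map ( *%g y^-1) L.
  by move=> /branch_translate/bL iv; apply/mapP; exists (y * v); rewrite ?mulKg.
have aux Z : leaf Z a -> good Gs Z a -> uniq_cross Hs Z -> tame Z ->
    (forall c, ~ pur Z a c) -> (forall v, branch Z v -> v \in map ( *%g y^-1) L) ->
    sideb Z a false (linv a) -> Sep Z.
  move=> lfZ gdZ uZ tZ npZ bZ s.
  have [c1 P2] := good_leaf cm nlS wh lfZ uZ gdZ s.
  apply: (restrict_Sep lfZ); first by move=> l; apply: (cap1_closed wh nl2 c1).
  have i1 := bZ _ (leaf_branch lfZ npZ).
  apply: (IH _ (rem 1 (map ( *%g y^-1) L))).
  - have L0 : 0 < size L by case: (L) i1.
    by rewrite size_rem // size_map -ltnS prednK.
  - exact: tame_and tZ (tame_cone _).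
  - exact: restrict_essential.
  - exact: restrict_uniq_cross.
  move=> v /(restrict_branch lfZ)[v1 /bZ iv].
  by have := perm_to_rem i1 => /perm_mem/(_ v); rewrite iv inE (negbTE v1) /=.
have [s|s] := leaf_side lfY (linv_neq a); last exact: (aux Y).
apply: Sep_neg; apply: aux.
- exact: leaf_neg.
- exact: good_neg.
- exact: uniq_cross_neg.
- exact: tame_neg.
- by move=> c; rewrite -(negbK c) pur_neg.
- by move=> v /branch_neg/bY.
by case/sidebP: s => n' p; apply/sidebP; split=> //; apply/(pur_neg Y _ true).
Qed.

Lemma no_nonseparating X : tame X -> essential X -> uniq_cross Hs X -> Sep X.
Proof.
move=> tX es uX; have [L HL] := branch_finite tX.
exact: (@uniq_cross_Sep (size L).+1 X L).
Qed.

End Induction.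

(** * Visible cleavings *)

Section Cleaving.
Variable B : finType.
Local Open Scope group_scope.
Implicit Types (l m : letter B) (G : lgraph B) (E : pred B) (x y v : nat).

Lemma conn_byE G E x y : conn_by G (fun e => E (elab e)) x y <->
  exists w : word B, all (fun l => E l.1) w /\ rd G x w y.
Proof.
split=> [[p [a e]]|[w [a /rdP[p [e el]]]]].
  exists (walk_label p); split; first by rewrite all_map.
  by apply/rdP; exists p.
by exists p; split=> //; rewrite -el all_map in a.
Qed.

Definition incident G E x := has (fun e => E (elab e) && ((esrc e == x) || (etgt e == x))) (edges G).

Lemma incidentP G E x : incident G E x <-> exists2 l, E l.1 & starb G x l.
Proof.
split=> [/hasP[e ie /andP[Ee /orP[]/eqP ex]]|[l El /hasP[e ie /andP[/eqP le /eqP ex]]]].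
- by exists (elab e, false) => //; apply/hasP; exists e; rewrite //= ex !eqxx.
- by exists (elab e, true) => //; apply/hasP; exists e; rewrite //= ex !eqxx.
by apply/hasP; exists e; rewrite // le El -ex; case: (l.2); rewrite eqxx ?orbT.
Qed.

Lemma step_incident G E x l y : step G x l y -> E l.1 -> incident G E x /\ incident G E y.
Proof.
move=> st El; split; apply/incidentP; first by exists l => //; apply/starbP; exists y.
by exists (linv l) => //; apply/starbP; exists x; rewrite step_linv.
Qed.

(** The walk is cut at its first visit to [v]; before that no vertex meets both label sets, so the
    walk cannot change sides. *)
Lemma walk_to_cut G E v x w : (forall z, incident G E z -> incident G (predC E) z -> z = v) ->
  (x == v) || incident G E x -> rd G x w v ->
  exists w' : word B, all (fun l => E l.1) w' /\ rd G x w' v.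
Proof.
move=> nc; elim: w x => [|l w IH] x /=; first by move=> _ ->; exists [::].
case: eqP => [-> _ _|/eqP xv /= ix [z [st r]]]; first by exists [::].
have El : E l.1.
  apply: contraT => nE; have [i1 _] := step_incident (E := predC E) st nE.
  by rewrite (nc x ix i1) eqxx in xv.
have [_ iz] := step_incident st El.
have [||w' [a r']] := IH z; rewrite ?iz ?orbT //.
by exists (l :: w'); split; rewrite /= ?El //; exists z.
Qed.

Lemma conn_through_cut G E v : connected G -> v < nv G ->
  (forall z, incident G E z -> z < nv G) ->
  (forall z, incident G E z -> incident G (predC E) z -> z = v) ->
  forall x y, (x == v) || incident G E x -> (y == v) || incident G E y ->
  conn_by G (fun e => E (elab e)) x y.
Proof.
move=> cn lv lt nc x y ix iy.
have to z : (z == v) || incident G E z ->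
    exists w : word B, all (fun l => E l.1) w /\ rd G z w v.
  move=> iz; have lz : z < nv G by case/orP: iz => [/eqP->|/lt].
  have [p [_ e]] := cn z v lz lv.
  by apply: (@walk_to_cut _ _ _ _ (walk_label p)) => //; apply/rdP; exists p.
have [w1 [a1 r1]] := to x ix; have [w2 [a2 r2]] := to y iy.
apply/conn_byE; exists (w1 ++ winv w2); split.
  by rewrite all_cat a1 /winv all_rev all_map.
by apply/rd_cat; exists v; split=> //; apply: rd_winv.
Qed.

Lemma incident_lt G E x : wf_graph G -> incident G E x -> x < nv G.
Proof.
move=> wf /incidentP[l _ /starbP[y st]]; by case: (step_wf wf st).
Qed.

Lemma cross_incident Gs (P : {set B}) j x :
  incident (nth (G0 B) Gs j) (mem P) x -> incident (nth (G0 B) Gs j) (predC (mem P)) x ->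
  crossv Gs (fun l => l.1 \in P) (j, x).
Proof.
move=> /incidentP[l lP sl] /incidentP[m mP sm].
by apply/crossvP; exists l, m.
Qed.

Lemma wedge_of_cut G (P : {set B}) v : wf_graph G -> connected G ->
  (forall z, z < nv G -> 1 < degree G z) -> v < nv G ->
  (forall z, incident G (mem P) z -> incident G (predC (mem P)) z -> z = v) ->
  wedge P G.
Proof.
move=> wf cn dg lv nc; exists v; split=> //; rewrite /=; split.
- move=> x lx; have := dg x lx; rewrite /degree => d.
  suff /hasP[e ie xe] : has (fun e => (esrc e == x) || (etgt e == x)) (edges G).
    have [eP|nP] := boolP (elab e \in P); apply/orP; [left|right]; apply/orP; right;
    by apply/hasP; exists e; rewrite ?eP ?nP.
  rewrite has_predU !has_count; lia.
- by move=> x; case: eqP => [//|_] /= h1 h2; apply: nc.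
- apply: (conn_through_cut (E := mem P)) => // z; exact: incident_lt.
apply: (conn_through_cut (E := predC (mem P))) => // z; first exact: incident_lt.
move=> h1 h2; apply: nc => //; apply: sub_has h2 => e /=.
by rewrite negbK.
Qed.

(** A walk joining edges of different sides would pass through a vertex meeting both. *)
Lemma one_sided G (P : {set B}) : wf_graph G -> connected G ->
  (forall z, incident G (mem P) z -> ~~ incident G (predC (mem P)) z) ->
  all (fun e => elab e \in P) (edges G) \/ all (fun e => elab e \notin P) (edges G).
Proof.
move=> wf cn nc; have [|/allPn[e2 i2 n2]] := boolP (all (fun e => elab e \in P) (edges G)).
  by left.
right; apply/allPn => -[e1 i1 /negPn n1].
have inc (F : pred B) e : e \in edges G -> F (elab e) -> incident G F (esrc e).
  by move=> ie Fe; apply/hasP; exists e; rewrite ?Fe ?eqxx.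
have l1 : esrc e1 < nv G by have /allP/(_ _ i1)/andP[] := wf.
have l2 : esrc e2 < nv G by have /allP/(_ _ i2)/andP[] := wf.
have [p [_ e]] := cn _ _ l1 l2.
have r : rd G (esrc e1) (walk_label p) (esrc e2) by apply/rdP; exists p.
have prop w x y : rd G x w y -> incident G (mem P) x -> incident G (mem P) y.
  elim: w x => [|l w IH] x /=; first by move->.
  case=> z [st r'] ix; apply: IH r' _.
  have lP : l.1 \in P.
    apply: contraT => nl; have [i _] := step_incident (E := predC (mem P)) st nl.
    by have := nc _ ix; rewrite i.
  by case: (step_incident (E := mem P) st lP).
have := nc _ (prop _ _ _ r (inc (mem P) _ i1 n1)).
by rewrite (inc (predC (mem P)) _ i2 n2).
Qed.

Lemma count_le1_eq (T : eqType) (s : seq T) (a : pred T) (x y : T) : count a s <= 1 ->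
  x \in s -> y \in s -> a x -> a y -> x = y.
Proof.
move=> c ix iy ax ay; apply/eqP; apply: contraT => ne; move: c.
rewrite leqNgt -size_filter => /negP[]; apply: (@uniq_leq_size _ [:: x; y]).
  by rewrite /= inE ne.
by move=> z; rewrite !inE mem_filter => /orP[]/eqP->; apply/andP.
Qed.

(** Closure under inversion turns [C] into a set [P] of basis elements, and the only crossing
    vertex, if there is one, is the wedge point. *)
Lemma cleaved_of_cap Hs (Gs : seq (lgraph B)) (C : pred (letter B)) : sigma_seq Hs Gs ->
  cap C Gs <= 1 -> (forall l, C l -> C (linv l)) -> (exists l, C l) -> (exists l, ~~ C l) ->
  (forall b : B, 0 < nlab b Gs) -> visibly_cleaved Gs.
Proof.
move=> sg c1 Cl [l Cl0] [m Cm0] nl0; have [sz cor] := sg.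
pose P := [set b : B | C (b, false)].
have CP k : C k = (k.1 \in P).
  by rewrite inE; case: k => b [] //=; apply/idP/idP => /Cl.
have CE : C = (fun k => k.1 \in P) by apply: funext.
have [[i0 v] [iv cu]] : exists jx, jx \in verts Gs /\
    forall jy, jy \in verts Gs -> crossv Gs C jy -> jy = jx.
  (* Without a crossing vertex any vertex serves as wedge point, one factor of the wedge being that
     point alone; [nl0] ensures that a vertex exists. *)
  have [/hasP[jx ij cj]|/hasPn no] := boolP (has (crossv Gs C) (verts Gs)).
    by exists jx; split=> // jy iy cy; apply: (count_le1_eq c1).
  have := nl0 l.1; rewrite (nlab_star l sg) -has_count => /hasP[jx ij _].
  by exists jx; split=> // jy iy cy; have := no jy iy; rewrite cy.
rewrite CE in cu; move: iv; rewrite mem_verts => /andP[li lv].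
exists P; split.
- by apply/set0Pn; exists l.1; rewrite -CP.
- by apply/set0Pn; exists m.1; rewrite inE -CP.
exists i0; split=> //.
  have li' := li; rewrite sz in li'; have [wf fd cn dg _] := cor i0 li'.
  apply: (wedge_of_cut wf cn dg lv) => z h1 h2.
  have iz : (i0, z) \in verts Gs by rewrite mem_verts li (incident_lt wf h1).
  by have [->] := cu _ iz (cross_incident h1 h2).
move=> i li' ni; rewrite sz in li'; have [wf fd cn dg _] := cor i li'.
apply: one_sided => // z h1; apply/negP => h2.
have iz : (i, z) \in verts Gs by rewrite mem_verts sz li' (incident_lt wf h1).
by have [ei _] := cu _ iz (cross_incident h1 h2); rewrite ei eqxx in ni.
Qed.

Lemma cleaved_unique_cross (Gs : seq (lgraph B)) (P : {set B}) i0 :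
  wedge P (nth (G0 B) Gs i0) ->
  (forall i, i < size Gs -> i != i0 ->
        all (fun e => elab e \in P) (edges (nth (G0 B) Gs i)) \/
        all (fun e => elab e \notin P) (edges (nth (G0 B) Gs i))) ->
  forall jx jy, jx \in verts Gs -> jy \in verts Gs ->
    crossv Gs (fun l => l.1 \in P) jx -> crossv Gs (fun l => l.1 \in P) jy -> jx = jy.
Proof.
move=> [v [lv [_ nc _ _]]] sides.
suff H jx : jx \in verts Gs -> crossv Gs (fun l => l.1 \in P) jx -> jx = (i0, v).
  by move=> jx jy ix iy cx cy; rewrite (H _ ix cx) (H _ iy cy).
case: jx => i x; rewrite mem_verts => /andP[li lx] /crossvP[l [m [lP mP sl sm]]].
have h1 : incident (nth (G0 B) Gs i) (mem P) x by apply/incidentP; exists l.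
have h2 : incident (nth (G0 B) Gs i) (predC (mem P)) x by apply/incidentP; exists m.
have [ei|ni] := eqVneq i i0.
  by subst i; rewrite (nc x) //; apply/orP; right.
case: (sides i li ni) => /allP sd.
  by case/hasP: h2 => e /sd ie /andP[]; rewrite /= ie.
by case/hasP: h1 => e /sd ie /andP[/= +]; rewrite (negbTE ie).
Qed.

Lemma uniq_cross_of_crossv (Hs : seq (seq (word B))) Gs ps (C : pred (letter B)) :
  coset_model Hs Gs ps ->
  (forall jx jy, jx \in verts Gs -> jy \in verts Gs ->
    crossv Gs C jx -> crossv Gs C jy -> jx = jy) -> uniq_cross Hs (cone C).
Proof.
move=> cm H j j' g g' lj lj' c1 c2.
have [x [ix px cx]] := crosses_crossv cm lj c1.
have [x' [ix' px' cx']] := crosses_crossv cm lj' c2.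
have [ej ex] := H _ _ ix ix' cx cx'; subst j' x'; split=> //.
exact/(cm_eq cm px px').
Qed.

Lemma uniq_cross_auto (Hs1 Hs2 : seq (seq (word B))) f f' X : auto f f' ->
  size Hs2 = size Hs1 -> (forall j g, Kf Hs2 j g <-> Kf Hs1 j (f' g)) ->
  uniq_cross Hs2 X -> uniq_cross Hs1 (fun w => X (f w)).
Proof.
move=> af sz KK uX; have [fM f'M fK f'K] := af.
have cr j g : crosses (sconj (Kf Hs1 j) g) (fun w => X (f w)) ->
    crosses (sconj (Kf Hs2 j) (f g)) X.
  have -> : Kf Hs2 j = fun k => Kf Hs1 j (f' k) by apply: funext => k; apply: propext.
  by rewrite (crosses_auto _ _ _ af) fK.
move=> j j' g g' lj lj' /cr c1 /cr c2; rewrite -sz in lj lj'.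
have [-> H] := uX _ _ _ _ lj lj' c1 c2; split=> //.
by move/KK: H; rewrite -(morphV fM) -fM fK.
Qed.

Lemma essential_auto f f' (X : fg B -> bool) : auto f f' -> essential X ->
  essential (fun w => X (f w)).
Proof.
move=> af es c M; have [N HN] := auto_long (auto_sym af) M.
have [g lg Xg] := es c N; exists (f' g); first exact: HN.
by have [_ _ _ f'K] := af; rewrite f'K.
Qed.

Lemma essential_cone (C : pred (letter B)) l m : C l -> ~~ C m -> essential (cone C).
Proof.
move=> Cl Cm [] M; [have [g [s [e lg]]] := long_word l M|have [g [s [e lg]]] := long_word m M].
  by exists g; rewrite // /cone e.
by exists g; rewrite // /cone e; apply: negbTE.
Qed.

(** The comparison map is [a] composed with the inverse of [b]. *)
Lemma compare_auto a b (Hs : seq (seq (word B))) : is_aut a -> is_aut b ->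
  exists f f', auto f f' /\
    forall j g, Kf (aut_act a Hs) j g <-> Kf (aut_act b Hs) j (f' g).
Proof.
move=> /is_autE[a' aa] /is_autE[b' ab].
exists (fun g => Ext a (Ext b' g)), (fun g => Ext b (Ext a' g)); split.
  case: aa ab => aM a'M aK a'K [bM b'M bK b'K]; split=> [g h|g h|g|g].
  - by rewrite b'M aM.
  - by rewrite a'M bM.
  - by rewrite aK b'K.
  - by rewrite bK a'K.
move=> j g; rewrite (Kf_aut_act _ _ _ aa) (Kf_aut_act _ _ _ ab).
by case: ab => _ _ -> _.
Qed.

(** If [b] labelled at most one edge in the other basis, its dual sphere would be crossed by at most
    one coset. Pulled back to the Gersten representative it would be null-homologous by
    [no_nonseparating], against [not_Sep_letter]. *)
Lemma minlex_any beta a (Hs : seq (seq (word B))) Gs Ga :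
  gersten beta Hs -> sigma_seq (aut_act beta Hs) Gs -> (forall b : B, 1 < nlab b Gs) ->
  is_aut a -> sigma_seq (aut_act a Hs) Ga -> forall b : B, 1 < nlab b Ga.
Proof.
move=> gb sg nl aa sa b; rewrite ltnNge; apply/negP => le1.
have [ps cm] := coset_model_exists sg; have [pa ca] := coset_model_exists sa.
have [f [f' [af KK]]] := compare_auto Hs aa gb.1.
pose C : pred (letter B) := pred1 (b, false).
have uC : uniq_cross (aut_act a Hs) (cone C).
  apply: (uniq_cross_of_crossv ca) => jx jy ix iy cx cy.
  by apply: (count_le1_eq _ ix iy cx cy); rewrite -[count _ _](nlab_cap (b, false) sa).
have sz : size (aut_act a Hs) = size (aut_act beta Hs) by rewrite !size_map.
have uX := uniq_cross_auto af sz KK uC.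
have es : essential (cone C).
  by apply: (@essential_cone _ (b, false) (b, true)); rewrite /C /= ?eqxx ?xpair_eqE ?andbF.
apply: (@not_Sep_letter _ f f' b af).
apply: (no_nonseparating cm (fun l => nlab_star l sg) _ nl _ _ uX).
- by move=> D l; apply: whitehead_ineq gb sg.
- exact: tame_auto af (tame_cone C).
- exact: essential_auto af es.
Qed.

(** The partition of a visible cleaving is crossed by at most one coset. This survives the pullback
    to the Gersten representative, where [surgery_cleaves] produces a partition of its own basis. *)
Lemma cleaved_any beta a (Hs : seq (seq (word B))) Gs Ga :
  gersten beta Hs -> sigma_seq (aut_act beta Hs) Gs -> (forall b : B, 1 < nlab b Gs) ->
  is_aut a -> sigma_seq (aut_act a Hs) Ga -> visibly_cleaved Ga -> visibly_cleaved Gs.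
Proof.
move=> gb sg nl aa sa [P [/set0Pn[b1 i1] /set0Pn[b2]]]; rewrite inE => i2 [i0 [_ wd sd]].
have [ps cm] := coset_model_exists sg; have [pa ca] := coset_model_exists sa.
have [f [f' [af KK]]] := compare_auto Hs aa gb.1.
pose C : pred (letter B) := fun l => l.1 \in P.
have uC : uniq_cross (aut_act a Hs) (cone C).
  exact: (uniq_cross_of_crossv ca) (cleaved_unique_cross wd sd).
have sz : size (aut_act a Hs) = size (aut_act beta Hs) by rewrite !size_map.
have uX := uniq_cross_auto af sz KK uC.
have es : essential (cone C) by apply: (@essential_cone _ (b1, false) (b2, false)).
have [|||D [c1 Dl ex nex]] := surgery_cleaves cm (fun l => nlab_star l sg) _ nl _ _ uX.
- by move=> D l; apply: whitehead_ineq gb sg.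
- exact: tame_auto af (tame_cone C).
- exact: essential_auto af es.
by apply: (cleaved_of_cap sg c1 Dl ex nex) => b; apply: ltnW.
Qed.

End Cleaving.

Theorem lemma9p17 (B : finType) (Hs : seq (seq (word B))) :
  (exists beta, gersten beta Hs /\
     exists Gs, sigma_seq (aut_act beta Hs) Gs /\ forall b : B, 1 < nlab b Gs) ->
  [<-> (exists a, is_aut a /\
          exists Gs, sigma_seq (aut_act a Hs) Gs /\ visibly_cleaved Gs);
       (exists beta, gersten beta Hs /\
          exists Gs, sigma_seq (aut_act beta Hs) Gs /\ visibly_cleaved Gs);
       (forall beta, gersten beta Hs ->
          forall Gs, sigma_seq (aut_act beta Hs) Gs -> visibly_cleaved Gs)].
Proof.
case=> beta [gb [Gs [sg nl]]]; tfae.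
- move=> [a [aa [Ga [sa va]]]]; exists beta; split=> //; exists Gs; split=> //.
  exact: cleaved_any gb sg nl aa sa va.
- move=> [b1 [[ab1 _] [G1 [s1 v1]]]] b2 gb2 G2 s2.
  (* The bound on the counts is given for [beta] only and has to be carried over to [b2]. *)
  have nl2 := minlex_any gb sg nl gb2.1 s2.
  exact: cleaved_any gb2 s2 nl2 ab1 s1 v1.
move=> H; exists beta; split; first exact: gb.1.
by exists Gs; split=> //; apply: H gb _ sg.
Qed.
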